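(* Let $k$ be a field (of any characteristic) and $A$ a $k$-algebra. If $A$ is a retract of $B = k^{[3]}$ and there exists a non-trivial exponential map $\sigma$ on $B$ such that $A = B^{\sigma}$, then $A \cong k^{[2]}$ as $k$-algebras.
   Context: $k^{[n]}$ denotes the polynomial ring in $n$ variables over $k$. A $k$-subalgebra $A$ of a $k$-algebra $B$ is a retract of $B$ if it satisfies one of the following equivalent conditions: there is an idempotent $k$-algebra endomorphism $\varphi$ of $B$ with $\varphi(B) = A$; there is a $k$-algebra homomorphism $\varphi : B \to A$ with $\varphi|_A = \mathrm{id}_A$; there is an ideal $I$ of $B$ with $B = A \oplus I$ as $A$-modules. An exponential map on a $k$-algebra $B$ that is an integral domain is a $k$-algebra homomorphism $\sigma : B \to B^{[1]}$ (target: the polynomial ring in one variable over $B$) with the following properties, where for an indeterminate $U$ over $B$ we write $\sigma_U : B \to B[U]$ for the map $\sigma$: (i) $\epsilon_0 \circ \sigma_U = \mathrm{id}_B$, where $\epsilon_0 : B[U] \to B$ is evaluation at $U = 0$; (ii) for indeterminates $U, V$, $\sigma_V \circ \sigma_U = \sigma_{U+V}$, where $\sigma_V : B \to B[V]$ is extended to a $k$-algebra homomorphism $\sigma_V : B[U] \to B[U,V]$ by $\sigma_V(U) = U$. The ring of constants of $\sigma$ is $B^{\sigma} = \{x \in B \mid \sigma(x) = x\}$. The exponential map $\sigma$ is trivial if $B^{\sigma} = B$, and non-trivial otherwise. *)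

(* Defs.v *)
From HB Require Import structures.
From mathcomp Require Import all_boot all_order all_algebra.
From mathcomp Require Import mpoly.

Set Implicit Arguments.
Unset Strict Implicit.
Unset Printing Implicit Defensive.

Import GRing.Theory.
Local Open Scope ring_scope.

Section Subalgebra.
Variables (k : fieldType) (B : comAlgType k).

Definition subalg_type (A : subalgClosed B) : Type := {x : B | x \in A}.

HB.instance Definition _ (A : subalgClosed B) := Choice.on (subalg_type A).
HB.instance Definition _ (A : subalgClosed B) :=
  SubChoice.on (subalg_type A).
HB.instance Definition _ (A : subalgClosed B) :=
  [SubChoice_isSubAlgebra of subalg_type A by <:].

Definition is_retract (A : subalgClosed B) : Prop :=
  exists phi : {lrmorphism B -> B},
    (forall x, phi (phi x) = phi x) /\
    (forall x, x \in A <-> exists y, phi y = x).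

End Subalgebra.

Section ExponentialMap.
Variables (k : fieldType) (B : comAlgType k).

(* [{poly B}] is canonically an algebra over B, not over k; the scaling
   operator [in_alg B \; *:%R] makes k act on it through k -> B, so that the
   morphisms below are exactly the k-algebra homomorphisms B -> B[U]. *)
Definition poly_khom : Type :=
  {lrmorphism B -> {poly B} | GRing.in_alg B \; *:%R}.

(* Exponential maps are considered on integral domains B; the library has no
   join of [comAlgType k] and [idomainType], so this is left to the
   instantiation ({mpoly k[n]} is an integral domain).
   B[U, V] is encoded as [{poly {poly B}}], with U = ['X] the outer variable
   and V = ['X%:P] the inner one. [map_poly sigma] is then the extension
   B[U] -> B[U, V] of sigma_V fixing U, and
   [(sigma x)^:P \Po ('X + 'X%:P)] is sigma_{U+V}(x). *)
Record is_exponential_map (sigma : poly_khom) : Prop := {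
  exp_eval0 : forall x : B, (sigma x).[0] = x;
  exp_add : forall x : B,
    map_poly sigma (sigma x) = (sigma x)^:P \Po ('X + ('X)%:P)
}.

Definition exp_constants (sigma : poly_khom) : {pred B} :=
  [pred x | sigma x == x%:P].

Definition exp_nontrivial (sigma : poly_khom) : Prop :=
  ~ (exp_constants sigma =i predT).

End ExponentialMap.

Definition alg_isomorphic (k : fieldType) (A A' : algType k) : Prop :=
  exists f : {lrmorphism A -> A'}, bijective f.

(* Main.v *)
Require Import Defs.
From HB Require Import structures.
From mathcomp Require Import all_boot all_order all_algebra qfpoly.
From mathcomp Require Import mpoly ring zify.
From Stdlib Require Import Classical.

Set Implicit Arguments.
Unset Strict Implicit.
Unset Printing Implicit Defensive.

Import GRing.Theory.
Local Open Scope ring_scope.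

(** Write [B] for the polynomial ring in three variables, [sigma] for the
    exponential map, [A] for its ring of constants and [phi] for the retraction.

    The kernel of [phi] is generated by one prime element [t] of the factorial
    ring [B], because every element of the kernel has a nonzero multiple by an
    element of [A] that is divisible by [t] ([kernel_principal]). Splitting off
    multiples of [t] lowers the degree of [sigma] in its parameter, whence
    [B = A[t]] ([retract_polynomial_ring]). What remains is the cancellation theorem
    for the plane: [A[t] = k[x, y, z]] implies that [A] is a polynomial ring in
    two variables. The argument follows Crachiola and Makar-Limanov, arranged so
    as to work over every field.

    - [A] has a non-trivial exponential map [delta]. The shifts of [x], [y] and
      [z] have no common constants but the scalars, so one of them moves an
      element of [A]. Give [t] and the parameter [U] weights for which the terms
      of top weight survive; these leading forms fix [t], and setting [t = 1]
      gives an exponential map of [A] ([descend_exp_map]).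

    - The constants [C] of [delta] are [k[f]] for some [f]. Indeed [C] is
      factorial; having transcendence degree one, it embeds into a polynomial
      ring in one variable ([embed_constants]); and a factorial subalgebra of
      such a ring, other than [k], is a polynomial ring ([luroth]).

    - Let [s] have minimal positive degree for [delta]. Each element of [A],
      multiplied by a nonzero element of [k[f]], becomes a polynomial in [f] and
      [s] ([slice_generates]). To remove the denominator one has to understand
      the fibres [A / p(f)], for [p] irreducible: if [s] is algebraic modulo
      [p(f)], then it is congruent to some [c(f)] ([fibre_section]). Over an
      algebraically closed field this holds because [f - lambda] is irreducible
      in [A], being so in the factorially closed subring [k[f]]. In general,
      extend [delta] to [B] by fixing [t]. Its constants are [k[f, t]], and they
      become [L[f, t]] after an extension [L] of [k]; as [L[x, y, z]] is still
      factorial, [f - lambda] is prime in it for all [lambda] in [L]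
      ([fibre_prime]). So the fibres stay integral after adjoining the roots
      needed, and contain no algebraic elements outside the residue field of [p].

    - When [s] is congruent to [c(f)] modulo [p(f)], the element
      [(s - c(f)) / p(f)] has the same degree as [s] and a leading coefficient
      of smaller degree in [f]. Hence for the best [s] there are no denominators
      and [A = k[f, s]] ([cancellation]). *)

(** * Divisibility and unique factorization *)

Section Divisibility.
Variable R : idomainType.
Implicit Types (a b c p x y z : R) (s : seq R).

Definition divides x y : Prop := exists z, y = z * x.

Definition prime_elt p : Prop :=
  [/\ p != 0, p \isn't a GRing.unit
    & forall a b, divides p (a * b) -> divides p a \/ divides p b].

Lemma dvd_refl x : divides x x.
Proof. by exists 1; rewrite mul1r. Qed.

Lemma dvd_trans x y z : divides x y -> divides y z -> divides x z.
Proof. by case=> u -> [v ->]; exists (v * u); rewrite mulrA. Qed.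

Lemma dvd_mull x y z : divides x y -> divides x (z * y).
Proof. by case=> u ->; exists (z * u); rewrite mulrA. Qed.

Lemma dvd_mulr x y z : divides x y -> divides x (y * z).
Proof. by rewrite mulrC; apply: dvd_mull. Qed.

Lemma dvd_add x y z : divides x y -> divides x z -> divides x (y + z).
Proof. by case=> u -> [v ->]; exists (u + v); rewrite mulrDl. Qed.

Lemma dvd_opp x y : divides x y -> divides x (- y).
Proof. by case=> u ->; exists (- u); rewrite mulNr. Qed.

Lemma dvd_sub x y z : divides x y -> divides x z -> divides x (y - z).
Proof. by move=> xy /dvd_opp; apply: dvd_add. Qed.

Lemma prime_dvd_nonunit p x :
  prime_elt p -> divides p x -> x \isn't a GRing.unit.
Proof.
case=> _ pNU _ [z ->]; apply: contra pNU.
by rewrite unitrM => /andP[].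
Qed.

Lemma dvd_unitl x y u :
  u \is a GRing.unit -> divides x (u * y) -> divides x y.
Proof. by move=> uU /(dvd_mull u^-1); rewrite mulKr. Qed.

Lemma prime_dvd_prod p s :
  prime_elt p -> divides p (\prod_(q <- s) q) -> exists2 q, q \in s & divides p q.
Proof.
move=> pP; elim: s => [|q s IHs].
  by rewrite big_nil => /(prime_dvd_nonunit pP); rewrite unitr1.
rewrite big_cons; have [_ _ pM] := pP => /pM [pq|/IHs[r rs pr]].
  by exists q; rewrite ?mem_head.
by exists r; rewrite // in_cons rs orbT.
Qed.

(** Prime factors of the cofactor that do not divide [f] can be cancelled one
    at a time. *)
Lemma dvd_strip f b s : {in s, forall p, prime_elt p} ->
    {in s, forall p, ~ divides p f} ->
  divides f ((\prod_(p <- s) p) * b) -> divides f b.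
Proof.
elim: s => [|p s IHs] sP sf; first by rewrite big_nil mul1r.
rewrite big_cons -mulrA => -[z zE].
have [p0 _ pM] := sP p (mem_head _ _).
have [] := pM z f; first by rewrite -zE; apply/dvd_mulr/dvd_refl.
  case=> w wE; apply: IHs.
  - by move=> q qs; apply: sP; rewrite in_cons qs orbT.
  - by move=> q qs; apply: sf; rewrite in_cons qs orbT.
  by exists w; apply: (mulfI p0); rewrite zE wE; ring.
by move/(sf _ (mem_head _ _)).
Qed.

Definition ufd : Prop :=
  forall x, x != 0 -> exists u s,
    [/\ u \is a GRing.unit, {in s, forall p, prime_elt p}
      & x = u * \prod_(p <- s) p].

End Divisibility.

Section UfdFacts.
Variable R : idomainType.
Implicit Types (p x y : R) (s : seq R).

Lemma ufd_prime_factor : ufd R -> forall x, x != 0 ->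
  x \is a GRing.unit \/ exists2 p, prime_elt p & divides p x.
Proof.
move=> facR x /facR [u [[|p s] [uU sP ->]]].
  by left; rewrite big_nil mulr1.
right; exists p; first exact: (sP _ (mem_head _ _)).
by rewrite big_cons; apply/dvd_mull/dvd_mulr/dvd_refl.
Qed.

(** Such an element is associated to any of its prime factors. *)
Lemma ufd_irreducible x : ufd R -> x != 0 -> x \isn't a GRing.unit ->
    (forall y z, x = y * z -> y \is a GRing.unit \/ z \is a GRing.unit) ->
  prime_elt x.
Proof.
move=> facR x0 xU xI; case: (ufd_prime_factor facR x0) => [xU'|[p pP [z zE]]].
  by rewrite xU' in xU.
have [p0 pU pM] := pP.
case: (xI z p zE) => [zU|pU']; last by rewrite pU' in pU.
split=> // a b [w wE]; case: (pM a b).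
- by exists (w * z); rewrite wE zE mulrA.
- by case=> v vE; left; exists (v * z^-1); rewrite vE zE mulrA divrK.
- by case=> v vE; right; exists (v * z^-1); rewrite vE zE mulrA divrK.
Qed.

(** The measure for dividing out primes: by uniqueness of factorizations, each
    division by a prime shortens the list of prime factors by one. *)
Lemma prime_factor_length u p s y : u \is a GRing.unit ->
    {in s, forall q, prime_elt q} -> prime_elt p ->
    u * \prod_(q <- s) q = y * p ->
  exists w s', [/\ w \is a GRing.unit, {in s', forall q, prime_elt q},
    y = w * \prod_(q <- s') q & (size s').+1 = size s].
Proof.
move=> uU sP pP yE.
have /(dvd_unitl uU)/(prime_dvd_prod pP)[q qs [z zE]] :
  divides p (u * \prod_(q <- s) q) by exists y.
have [q0 qU qM] := sP q qs; have [p0 pU _] := pP.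
have zU : z \is a GRing.unit.
  case: (qM z p); rewrite -?zE; first exact: dvd_refl.
    case=> w wE; move: pU; rewrite (_ : p \is a GRing.unit) //.
    apply/unitrP; exists w; rewrite mulrC.
    have : p * w * q = 1 * q by rewrite mul1r {2}zE wE; ring.
    by move/(mulIf q0) => H; split; rewrite // mulrC.
  case=> w wE; apply/unitrP; exists w.
  have : w * z * p = 1 * p by rewrite mul1r {2}wE zE; ring.
  by move/(mulIf p0) => H; split; rewrite // mulrC.
exists (u * z), (rem q s); split.
- by rewrite unitrM uU.
- by move=> r /mem_rem; apply: sP.
- apply: (mulIf p0); rewrite -yE (big_rem q) //= {1}zE; ring.
- by rewrite size_rem // prednK //; case: (s) qs.
Qed.

End UfdFacts.

Lemma ufd_iso (R S : idomainType) (f : {rmorphism R -> S}) (g : S -> R) :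
  cancel f g -> cancel g f -> ufd R -> ufd S.
Proof.
move=> fK gK facR y y0.
have f_inj := can_inj fK.
have f_dvd a b : divides (f a) (f b) -> divides a b.
  by case=> z; rewrite -[z]gK -rmorphM => /f_inj ->; exists (g z).
have f_unit a : f a \is a GRing.unit -> a \is a GRing.unit.
  case/unitrP=> z [zf _]; apply/unitrP; exists (g z).
  have H : g z * a = 1 by apply: f_inj; rewrite rmorphM gK zf rmorph1.
  by rewrite [a * _]mulrC H.
have [|u [s [uU sP yE]]] := facR (g y).
  by apply: contra_neq y0 => gy0; rewrite -[y]gK gy0 rmorph0.
exists (f u), (map f s); split.
- exact: rmorph_unit.
- move=> _ /mapP[p /sP[p0 pU pM] ->]; split.
  + by rewrite -(rmorph0 f) (inj_eq f_inj).
  + by apply: contra pU; apply: f_unit.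
  + move=> a b; rewrite -[a]gK -[b]gK -rmorphM => /f_dvd/pM[] [z ->].
      by left; exists (f z); rewrite rmorphM.
    by right; exists (f z); rewrite rmorphM.
- by rewrite -[y]gK yE rmorphM rmorph_prod big_map.
Qed.

Lemma ufd_field (k : fieldType) : ufd k.
Proof.
by move=> x x0; exists x, [::]; rewrite big_nil mulr1 unitfE.
Qed.

Section Gauss.
Variable R : idomainType.
Implicit Types (p c : R) (f g h : {poly R}).

Lemma dvd_polyC_coef p f i : divides p%:P f -> divides p f`_i.
Proof. by case=> g ->; exists g`_i; rewrite coefMC. Qed.

Lemma unit_polyC p : (p%:P \is a GRing.unit) = (p \is a GRing.unit).
Proof.
rewrite poly_unitE coefC eqxx size_polyC.
by case: (eqVneq p 0) => [->|_] //=; rewrite unitr0.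
Qed.

(** Gauss's lemma. Subtracting the leading term of whichever factor has its
    leading coefficient divisible by [p] lowers the total degree. *)
Lemma prime_polyC p : prime_elt p -> prime_elt p%:P.
Proof.
case=> p0 pU pM; split; rewrite ?polyC_eq0 ?unit_polyC // => f g.
have [n] := ubnP (size f + size g)%N.
elim: n f g => // n IHn f g le_n fg.
have [->|f0] := eqVneq f 0; first by left; exists 0; rewrite mul0r.
have [->|g0] := eqVneq g 0; first by right; exists 0; rewrite mul0r.
have drop_lead h : h != 0 -> divides p (lead_coef h) ->
    exists2 h1 : {poly R}, (size h1 < size h)%N & exists e, h = h1 + e * p%:P.
  move=> h0 [z zE]; exists (h - (z%:P * 'X^((size h).-1)) * p%:P); last first.
    by exists (z%:P * 'X^((size h).-1)); rewrite subrK.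
  rewrite -[X in (_ < X)%N]prednK ?size_poly_gt0 // ltnS.
  apply/leq_sizeP => j le_j; rewrite coefB coefMC coefCM coefXn.
  have [->|ne_j] := eqVneq j (size h).-1; first by rewrite mulr1 -zE subrr.
  rewrite mulr0 mul0r subr0 nth_default //.
  by rewrite -(prednK (n := size h)) ?size_poly_gt0 // ltn_neqAle eq_sym ne_j.
have : divides p (lead_coef f * lead_coef g).
  by rewrite -lead_coefM; apply: dvd_polyC_coef.
have dE e : divides p%:P (e * p%:P) by exists e.
case/pM => [/drop_lead|/drop_lead] [] // h1 lt_h1 [e hE].
- have lt_n : (size h1 + size g < n)%N by lia.
  case: (IHn h1 g lt_n); last by right.
  + rewrite (_ : h1 * g = f * g - e * p%:P * g); last by rewrite hE; ring.
    by apply: dvd_sub => //; apply/dvd_mulr/dE.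
  + by move=> H; left; rewrite hE; apply: dvd_add.
- have lt_n : (size f + size h1 < n)%N by lia.
  case: (IHn f h1 lt_n).
  + rewrite (_ : f * h1 = f * g - f * (e * p%:P)); last by rewrite hE; ring.
    by apply: dvd_sub => //; apply/dvd_mull/dE.
  + by left.
  + by move=> H; right; rewrite hE; apply: dvd_add.
Qed.

Definition primitive f : Prop := forall p, prime_elt p -> ~ divides p%:P f.

Hypothesis facR : ufd R.

(** Each prime constant dividing [f] uses up one prime factor of the leading
    coefficient. *)
Lemma content_primitive f : f != 0 ->
  exists2 c : R, c != 0 & exists2 g, primitive g & f = c%:P * g.
Proof.
move=> f0; have [|u [s [uU sP]]] := facR (x := lead_coef f).
  by rewrite lead_coef_eq0.
have [n] := ubnP (size s); elim: n f f0 u s uU sP => // n IHn f f0 u s uU sP.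
rewrite ltnS => le_n lE.
case: (classic (primitive f)) => [fP|].
  by exists 1; [exact: oner_neq0 | exists f; rewrite ?mul1r].
case/not_all_ex_not => p Hp; case: (imply_to_and _ _ Hp) => pP /NNPP[g gE].
have p0 : p != 0 by case: pP.
have g0 : g != 0 by apply: contra_neq f0; rewrite gE => ->; rewrite mul0r.
have [|w [s' [wU sP' lgE sz]]] := prime_factor_length (y := lead_coef g) uU sP pP.
  by rewrite -lE gE lead_coefM lead_coefC.
have [|c c0 [h hP hE]] := IHn g g0 w s' wU sP' _ lgE; first by rewrite sz.
exists (c * p); first by rewrite mulf_neq0.
by exists h; rewrite // gE hE polyCM; ring.
Qed.

Lemma dvd_primitive c f h : c != 0 -> primitive f ->
  divides f (c%:P * h) -> divides f h.
Proof.
move=> /facR [u [s [uU sP ->]]] fP.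
rewrite polyCM -mulrA rmorph_prod => /(dvd_unitl _) H.
have {H} : divides f ((\prod_(p <- map polyC s) p) * h).
  by rewrite big_map; apply: H; rewrite unit_polyC.
apply: dvd_strip => _ /mapP[p ps ->]; first by apply/prime_polyC/sP.
by apply/fP/sP.
Qed.

Lemma primitive_dvd f g : primitive f -> divides g f -> primitive g.
Proof. by move=> fP gf p pP pg; apply: (fP p) => //; apply: dvd_trans gf. Qed.

Lemma primitive_const f : f != 0 -> (size f <= 1)%N -> primitive f ->
  f \is a GRing.unit.
Proof.
move=> f0 /size1_polyC fE fP; rewrite fE unit_polyC.
have c0 : f`_0 != 0 by apply: contra_neq f0; rewrite {2}fE => ->.
case: (ufd_prime_factor facR c0) => // -[p pP [z zE]].
by case: (fP p pP); exists z%:P; rewrite fE zE polyCM.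
Qed.

(** Let [f] be primitive without factors of lower positive degree, and suppose
    that [f] divides [a * b]. The gcd [d] of [f] and [a] over the fraction
    field is, up to constants, either [1] or [f]; clearing denominators against
    primitive polynomials turns this into [f] dividing [b] or [a]. *)
Lemma primitive_prime f : (1 < size f)%N -> primitive f ->
    (forall g h, f = g * h -> (size g <= 1)%N \/ (size h <= 1)%N) ->
  prime_elt f.
Proof.
move=> sz fP fI.
have f0 : f != 0 by rewrite -size_poly_gt0 ltnW.
split=> //; first by rewrite poly_unitE gtn_eqF.
move=> a b fab; set d := gcdp f a.
have d0 : d != 0 by rewrite gcdp_eq0 negb_and f0.
have [c1 c10 [d' dP dE]] := content_primitive d0.
have dvd_gcd g : (d %| g)%R -> divides d' g.
  case/Pdiv.Idomain.dvdpP => -[c q] /= c0 cE.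
  apply: (dvd_primitive c0 dP); rewrite mul_polyC cE dE.
  by exists (q * c1%:P); rewrite mulrA.
have [q qE] := dvd_gcd f (dvdp_gcdl f a).
have d'0 : d' != 0 by apply: contra_neq f0; rewrite qE => ->; rewrite mulr0.
have q0 : q != 0 by apply: contra_neq f0; rewrite qE => ->; rewrite mul0r.
case: (fI q d' qE) => [szq|szd].
- have qU : q \is a GRing.unit.
    by apply: primitive_const => //; apply: (primitive_dvd fP); exists d'; rewrite mulrC.
  left; rewrite qE; have [z ->] := dvd_gcd a (dvdp_gcdr f a).
  by exists (z / q); rewrite mulrA divrK.
- right; have [[u v] /= /eqpP[[e1 e2] /= /andP[e10 e20]]] := Bezoutp f a.
  rewrite -/d dE (size1_polyC szd) -!mul_polyC => uvE.
  have d'00 : d'`_0 != 0 by apply: contra_neq d'0 => d00; rewrite (size1_polyC szd) d00.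
  apply: (@dvd_primitive (e2 * (c1 * d'`_0))) => //; first by rewrite !mulf_neq0.
  rewrite !polyCM -uvE; case: fab => z zE.
  exists (e1%:P * (u * b + v * z)).
  transitivity (e1%:P * (u * b * f + v * (a * b))); first by ring.
  by rewrite zE; ring.
Qed.

Lemma primitive_factor f : f != 0 -> primitive f -> exists u s,
  [/\ u \is a GRing.unit, {in s, forall q, prime_elt q}
    & f = u * \prod_(q <- s) q].
Proof.
have [n] := ubnP (size f); elim: n f => // n IHn f; rewrite ltnS => le_n f0 fP.
have [sz|sz] := leqP (size f) 1.
  by exists f, [::]; rewrite big_nil mulr1; split=> //; apply: primitive_const.
case: (classic (forall g h, f = g * h -> (size g <= 1)%N \/ (size h <= 1)%N)).
  move=> fI; exists 1, [:: f]; rewrite big_seq1 mul1r unitr1; split=> //.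
  by move=> _ /[1!inE]/eqP->; apply: primitive_prime.
case/not_all_ex_not => g /not_all_ex_not[h H]; case: (imply_to_and _ _ H) => fE.
case/not_or_and => /negP; rewrite -ltnNge => szg /negP; rewrite -ltnNge => szh.
have g0 : g != 0 by rewrite -size_poly_gt0 ltnW.
have h0 : h != 0 by rewrite -size_poly_gt0 ltnW.
have szE : size f = (size g + size h).-1 by rewrite fE size_mul.
have [||ug [sg [ugU sgP gE]]] := IHn g _ g0.
- by apply: leq_trans le_n; rewrite szE; lia.
- by apply: (primitive_dvd fP); exists h; rewrite fE mulrC.
have [||uh [sh [uhU shP hE]]] := IHn h _ h0.
- by apply: leq_trans le_n; rewrite szE; lia.
- by apply: (primitive_dvd fP); exists g.
exists (ug * uh), (sg ++ sh); split; first by rewrite unitrM ugU.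
  by move=> q; rewrite mem_cat => /orP[/sgP|/shP].
by rewrite big_cat /= fE gE hE; ring.
Qed.

Theorem ufd_poly : ufd {poly R}.
Proof.
move=> f f0; have [c c0 [g gP fE]] := content_primitive f0.
have [u [s [uU sP cE]]] := facR c0.
have g0 : g != 0 by apply: contra_neq f0; rewrite fE => ->; rewrite mulr0.
have [v [t [vU tP gE]]] := primitive_factor g0 gP.
exists (u%:P * v), (map polyC s ++ t); split.
- by rewrite unitrM unit_polyC uU.
- move=> q; rewrite mem_cat => /orP[/mapP[p /sP pP ->]|/tP//].
  exact: prime_polyC.
- by rewrite big_cat big_map /= fE cE gE polyCM rmorph_prod; ring.
Qed.

End Gauss.

(** * Evaluation morphisms *)

Section Evaluation.
Variables (R S : comNzRingType) (iota : {rmorphism R -> S}) (z : S).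

Definition peval (P : {poly R}) : S := (map_poly iota P).[z].

Fact peval_zmod_morphism : zmod_morphism peval.
Proof. by move=> P Q; rewrite /peval rmorphB hornerD hornerN. Qed.

Fact peval_monoid_morphism : monoid_morphism peval.
Proof.
by split=> [|P Q]; rewrite /peval ?rmorph1 ?hornerC // rmorphM hornerM.
Qed.

HB.instance Definition _ := GRing.isZmodMorphism.Build {poly R} S peval
  peval_zmod_morphism.
HB.instance Definition _ := GRing.isMonoidMorphism.Build {poly R} S peval
  peval_monoid_morphism.

Lemma pevalC c : peval c%:P = iota c.
Proof. by rewrite /peval map_polyC hornerC. Qed.

Lemma pevalX : peval 'X = z.
Proof. by rewrite /peval map_polyX hornerX. Qed.

Lemma pevalXn n : peval 'X^n = z ^+ n.
Proof. by rewrite rmorphXn /= pevalX. Qed.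

Lemma peval_wide n (P : {poly R}) : (size P <= n)%N ->
  peval P = \sum_(i < n) iota P`_i * z ^+ i.
Proof.
move=> le_n; rewrite /peval (@horner_coef_wide _ n).
  by apply: eq_bigr => i _; rewrite coef_map.
exact: leq_trans (size_poly _ _) le_n.
Qed.

Lemma pevalE (P : {poly R}) : peval P = \sum_(i < size P) iota P`_i * z ^+ i.
Proof. exact: peval_wide. Qed.

Lemma pevalZ c (P : {poly R}) : peval (c *: P) = iota c * peval P.
Proof. by rewrite -mul_polyC rmorphM /= pevalC. Qed.

End Evaluation.

Lemma poly_hom_ext (R : comNzRingType) (S : nzRingType)
    (f g : {rmorphism {poly R} -> S}) :
  (forall c, f c%:P = g c%:P) -> f 'X = g 'X -> f =1 g.
Proof.
move=> fgC fgX P; rewrite -[P]coefK poly_def !rmorph_sum /=.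
by apply: eq_bigr => i _; rewrite -mul_polyC !rmorphM fgC !rmorphXn fgX.
Qed.

Lemma peval_at0 (R S : comNzRingType) (iota : {rmorphism R -> S}) (P : {poly R}) :
  peval iota 0 P = iota P`_0.
Proof. by rewrite /peval horner_coef0 coef_map. Qed.

Lemma polyX_factor (R : comNzRingType) (P : {poly R}) :
  P`_0 = 0 -> exists Q, P = Q * 'X.
Proof.
move=> P0; have /factor_theorem[Q ->] : root P 0 by rewrite /root horner_coef0 P0.
by exists Q; rewrite subr0.
Qed.

Lemma peval_comp (R S T : comNzRingType) (iota : {rmorphism R -> S}) z
    (f : {rmorphism S -> T}) P :
  f (peval iota z P) = peval (f \o iota) (f z) P.
Proof.
rewrite !pevalE rmorph_sum; apply: eq_bigr => i _.
by rewrite rmorphM rmorphXn.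
Qed.

(** * Polynomials in several variables *)

Lemma mpoly_hom_ext (k : comNzRingType) (n : nat) (S : nzRingType)
    (f g : {rmorphism {mpoly k[n]} -> S}) :
    (forall c, f c%:MP = g c%:MP) -> (forall i, f 'X_i = g 'X_i) -> f =1 g.
Proof.
move=> fgC fgX p; rewrite [p]mpolyE !rmorph_sum /=.
apply: eq_bigr => m _; rewrite -mul_mpolyC !rmorphM fgC mpolyXE_id !rmorph_prod.
by congr (_ * _); apply: eq_bigr => i _; rewrite !rmorphXn fgX.
Qed.

Lemma mpolyC_injective (k : nzRingType) n : injective (@mpolyC n k).
Proof. by apply: (can_inj (g := mcoeff 0)) => c; rewrite mcoeffC eqxx mulr1. Qed.

Lemma mpoly_unit_scalar (k : idomainType) n (u : {mpoly k[n]}) :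
  u \is a GRing.unit -> u = (u@_0)%:MP.
Proof. by move=> uU; have /andP[/eqP] : mpoly_unit u by []. Qed.

Section LastVariable.
Variables (k : fieldType) (n : nat).

Lemma muni_widen (i : 'I_n) :
  muni ('X_(widen_ord (leqnSn n) i) : {mpoly k[n.+1]}) = ('X_i)%:P.
Proof.
rewrite /muni mmapX mmap1U; case: splitP => [j|j] /= ij.
  by congr ('X__)%:P; apply/val_inj.
by have := ltn_ord i; rewrite ij ltnNge leq_addr.
Qed.

Lemma muni_last : muni ('X_ord_max : {mpoly k[n.+1]}) = 'X.
Proof.
rewrite /muni mmapX mmap1U; case: splitP => [j|j] //= nj.
by have := ltn_ord j; rewrite -nj ltnn.
Qed.

Lemma mwiden_var (i : 'I_n) :
  mwiden ('X_i : {mpoly k[n]}) = 'X_(widen_ord (leqnSn n) i).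
Proof. by rewrite mwidenX mnmwiden1; congr 'X_[U_(_)]; apply/val_inj. Qed.

Lemma widen_ord_lift (i : 'I_n) : widen_ord (leqnSn n) i = lift ord_max i.
Proof. by apply/val_inj; rewrite /= /bump leqNgt ltn_ord. Qed.

Definition from_muni : {rmorphism {poly {mpoly k[n]}} -> {mpoly k[n.+1]}} :=
  peval (@mwiden n k) 'X_ord_max.

Lemma from_muniK : cancel from_muni (@muni n k).
Proof.
apply: (poly_hom_ext (f := (@muni n k \o from_muni)) (g := idfun)) => /= [c|].
  rewrite pevalC.
  apply: (mpoly_hom_ext (f := @muni n k \o @mwiden n k) (g := polyC)) => /= [a|i].
    by rewrite mwidenC muniC.
  by rewrite mwiden_var muni_widen.
by rewrite pevalX muni_last.
Qed.

Lemma muniK : cancel (@muni n k) from_muni.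
Proof.
apply: (mpoly_hom_ext (f := from_muni \o @muni n k) (g := idfun)) => /= [c|i].
  by rewrite muniC pevalC /= mwidenC.
case: (unliftP ord_max i) => [j ->|->]; last by rewrite muni_last pevalX.
by rewrite -widen_ord_lift muni_widen pevalC /= mwiden_var.
Qed.

Lemma muni_eq0 (p : {mpoly k[n.+1]}) : (muni p == 0) = (p == 0).
Proof. by rewrite -(muni0 n k) (inj_eq (can_inj muniK)). Qed.

End LastVariable.

Lemma mpoly0_scalar (k : nzRingType) (p : {mpoly k[0]}) : p = (p@_0)%:MP.
Proof.
apply/mpolyP => m; rewrite mcoeffC (_ : m = 0%MM) ?eqxx ?mulr1 //.
by apply/mnmP; case.
Qed.

Lemma ufd_mpoly (k : fieldType) n : ufd {mpoly k[n]}.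
Proof.
elim: n => [|n IHn].
  pose f : k -> {mpoly k[0]} := @mpolyC 0 k.
  have fK : cancel f (mcoeff 0) by move=> c; rewrite mcoeffC eqxx mulr1.
  apply: (ufd_iso fK); last exact: ufd_field.
  by move=> p; apply: esym (mpoly0_scalar p).
exact: ufd_iso (@from_muniK k n) (@muniK k n) (ufd_poly IHn).
Qed.

Lemma mmap_muni (k : fieldType) n (S : comNzRingType)
    (iota : {rmorphism k -> S}) (h : 'I_n.+1 -> S) (p : {mpoly k[n.+1]}) :
  mmap iota h p =
  peval (mmap iota (fun i => h (widen_ord (leqnSn n) i))) (h ord_max) (muni p).
Proof.
apply: (mpoly_hom_ext (f := mmap iota h) (g := peval _ _ \o @muni n k)) => /= [c|i].
  by rewrite muniC pevalC /= !mmapC.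
rewrite mmapX mmap1U; case: (unliftP ord_max i) => [j ->|->].
  by rewrite -widen_ord_lift muni_widen pevalC /= mmapX mmap1U.
by rewrite muni_last pevalX.
Qed.

Section Counting.
Variables (k : fieldType) (n : nat).

Lemma msizeM_leq (p q : {mpoly k[n]}) : (msize (p * q) <= (msize p + msize q).-1)%N.
Proof.
have [->|p0] := eqVneq p 0; first by rewrite mul0r msize0.
have [->|q0] := eqVneq q 0; first by rewrite mulr0 msize0.
by rewrite msizeM.
Qed.

Lemma linear_dependence (I : finType) (b : I -> {mpoly k[n]}) D :
    (forall i, (msize (b i) <= D)%N) -> (#|{: 'X_{1..n < D}}| < #|I|)%N ->
  exists2 c : I -> k, exists i, c i != 0 & \sum_i c i *: b i = 0.
Proof.
move=> le_D lt_I.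
pose M := \matrix_(i < #|I|, j < #|{: 'X_{1..n < D}}|)
  (b (enum_val i))@_(enum_val j : 'X_{1..n < D}).
have : kermx M != 0.
  rewrite kermx_eq0 -row_leq_rank -ltnNge.
  exact: leq_ltn_trans (rank_leq_col M) lt_I.
case/matrix0Pn => i0 [j0 nz].
exists (fun i => kermx M i0 (enum_rank i)).
  by exists (enum_val j0); rewrite enum_valK.
apply/mpolyP => m; rewrite mcoeff0 raddf_sum /=.
have [lt_m|le_m] := ltnP (mdeg m) D; last first.
  rewrite big1 // => i _; rewrite mcoeffZ memN_msupp_eq0 ?mulr0 //.
  by apply/negP => /msize_mdeg_lt; rewrite ltnNge (leq_trans (le_D i)).
have := congr1 (fun A : 'M_(_, _) => A i0 (enum_rank (BMultinom lt_m))) (mulmx_ker M).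
rewrite !mxE => /= E; rewrite -[RHS]E (reindex_onto enum_val enum_rank) /=; last first.
  by move=> i _; rewrite enum_rankK.
rewrite (eq_bigl xpredT) => [|i]; last by rewrite enum_valK eqxx.
by apply: eq_bigr => i _; rewrite mcoeffZ !mxE enum_valK enum_rankK.
Qed.

Lemma card_bounded_monomials D : (#|{: 'X_{1..n < D}}| <= D ^ n)%N.
Proof.
have lt_D (m : 'X_{1..n < D}) i : (m i < D)%N.
  apply: leq_ltn_trans (bmdeg m).
  by rewrite mdegE (bigD1 i) //= leq_addr.
pose f (m : 'X_{1..n < D}) := [ffun i : 'I_n => Ordinal (lt_D m i)].
have f_inj : injective f.
  move=> m m' /ffunP E; apply/val_inj/mnmP => i.
  by have := congr1 val (E i); rewrite !ffunE.
by have := leq_card f f_inj; rewrite card_ffun !card_ord.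
Qed.

(** There are [N ^ n.+1] monomials in [n.+1] elements with exponents below [N],
    and they lie in a space whose dimension is [O(N ^ n)]. *)
Lemma algebraic_dependence (h : 'I_n.+1 -> {mpoly k[n]}) :
  exists2 P : {mpoly k[n.+1]}, P != 0 & mmap (@mpolyC n k) h P = 0.
Proof.
pose d := \max_i msize (h i); pose E := (n.+1 * d).+1; pose N := (E ^ n).+1.
pose b (a : {ffun 'I_n.+1 -> 'I_N}) := \prod_i h i ^+ a i.
have le_b a : (msize (b a) <= N * E)%N.
  apply: (@leq_trans (\sum_(i < n.+1) N * d).+1); last first.
    by rewrite sum_nat_const card_ord /E mulnS mulnCA -add1n leq_add2r.
  rewrite /b; elim/big_rec2: _ => [|i p q _ IH]; first by rewrite msize1.
  have hX : (msize (h i ^+ a i) <= (a i * d).+1)%N.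
    elim: (nat_of_ord (a i)) => [|m IHm]; first by rewrite expr0 msize1.
    rewrite exprS; apply: leq_trans (msizeM_leq _ _) _.
    have : (msize (h i) <= d)%N by apply: (leq_bigmax_cond (F := fun i => msize (h i))).
    by lia.
  apply: leq_trans (msizeM_leq _ _) _.
  have : (a i * d <= N * d)%N by rewrite leq_mul2r ltnW ?orbT.
  by lia.
have [|c [a0 ca0] cE] := linear_dependence le_b.
  apply: leq_ltn_trans (card_bounded_monomials _) _.
  by rewrite card_ffun !card_ord expnMn mulnC expnS ltn_mul2r expn_gt0 /=.
pose P : {mpoly k[n.+1]} := \sum_a c a *: 'X_[[multinom (a i : nat) | i < n.+1]].
exists P.
  apply: contra_neq ca0 => /(congr1 (mcoeff [multinom (a0 i : nat) | i < n.+1])).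
  rewrite mcoeff0 raddf_sum /= (bigD1 a0) //= mcoeffZ mcoeffX eqxx mulr1.
  rewrite big1 ?addr0 // => a ne_a; rewrite mcoeffZ mcoeffX.
  case: eqP => [/mnmP E1|]; last by rewrite mulr0.
  case/eqP: ne_a; apply/ffunP => i; apply/val_inj.
  by have := E1 i; rewrite !mnmE.
rewrite -[RHS]cE raddf_sum /=; apply: eq_bigr => a _.
rewrite mmapZ mmapX mul_mpolyC; congr (_ *: _).
by apply: eq_bigr => i _; rewrite mnmE.
Qed.

End Counting.

(** Substituting [X ^ M] with [M] huge for the last variable keeps the monomials
    of different degrees in that variable apart. *)
Lemma kronecker_substitution (k : fieldType) n (g : {mpoly k[n]}) : g != 0 ->
  exists w : 'I_n -> {poly k}, mmap polyC w g != 0 /\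
    ((forall c, g != c%:MP) -> (1 < size (mmap polyC w g))%N).
Proof.
elim: n g => [|n IHn] g g0.
  have gE := mpoly0_scalar g.
  exists (fun=> 0); split; last by move/(_ g@_0); rewrite -gE eqxx.
  rewrite gE mmapC polyC_eq0; apply: contra_neq g0 => g00.
  by rewrite gE g00.
set P := muni g; have P0 : P != 0 by rewrite muni_eq0.
have [|w [w0 w1]] := IHn (lead_coef P); first by rewrite lead_coef_eq0.
pose psi := mmap polyC w : {mpoly k[n]} -> {poly k}.
pose M := (\max_(i < size P) size (psi P`_i)%R).+1.
pose w' (i : 'I_n.+1) : {poly k} :=
  if unlift ord_max i is Some j then w j else 'X^M.
exists w'.
have wE : (fun i : 'I_n => w' (widen_ord (leqnSn n) i)) =1 w.
  by move=> i; rewrite /w' widen_ord_lift liftK.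
have E : mmap polyC w' g = \sum_(i < size P) psi P`_i * 'X^(M * i).
  rewrite mmap_muni pevalE -/P; apply: eq_bigr => i _; rewrite /w' unlift_none -exprM.
  congr (_ * _); apply: eq_bigr => m _; congr (_ * _).
  by apply: eq_bigr => j _; rewrite -wE.
pose d := (size P).-1.
have dE : size P = d.+1 by rewrite /d prednK // size_poly_gt0.
have le_M (i : 'I_(size P)) : (size (psi P`_i)%R < M)%N.
  by rewrite ltnS; apply: (leq_bigmax_cond (F := fun i : 'I__ => size (psi P`_i)%R)).
have topE : size (mmap polyC w' g) = (size (psi (lead_coef P)) + M * d)%N.
  rewrite E dE big_ord_recr /= addrC.
  have dlt : (d < size P)%N by rewrite dE.
  have szX : size (psi P`_d * 'X^(M * d)) = (size (psi (lead_coef P)) + M * d)%N.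
    by rewrite size_mulXn -?lead_coefE // addnC.
  rewrite size_polyDl szX //; apply: (@leq_ltn_trans (M * d)); last first.
    by rewrite -[X in (X < _)%N]add0n ltn_add2r size_poly_gt0.
  apply: leq_trans (size_sum _ _ _) _; apply/bigmax_leqP => i _.
  have [->|nz] := eqVneq (psi P`_i) 0; first by rewrite mul0r size_poly0.
  rewrite size_mulXn //; have lt_i : (i < size P)%N by rewrite dE ltnS ltnW.
  have := le_M (Ordinal lt_i); have := ltn_ord i => /= lt_id lt_M.
  by have : (M * i.+1 <= M * d)%N by [rewrite leq_mul2l lt_id orbT]; rewrite mulnS; lia.
rewrite -size_poly_gt0 topE; have sz0 : (0 < size (psi (lead_coef P)))%N by rewrite size_poly_gt0.
split; first by lia.
move=> gN; case: (posnP d) => [d0|d0]; last by nia.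
rewrite d0 muln0 addn0; apply: w1 => c; apply: contraNneq (gN c) => lE.
apply/eqP/(can_inj (@muniK k n)); rewrite muniC -/P -lE lead_coefE -/d d0.
by apply: size1_polyC; rewrite dE d0.
Qed.

(** * Exponential maps and their constants *)

Section Constants.
Variable R : idomainType.
Implicit Types (x y : R) (sigma : {rmorphism R -> {poly R}}).

Definition at_zero sigma : Prop := forall x, (sigma x)`_0 = x.

(** Coefficientwise form of [sigma_V \o sigma_U = sigma_(U + V)]. *)
Definition exp_law sigma : Prop := forall x i j,
  (sigma (sigma x)`_j)`_i = (sigma x)`_(i + j) *+ 'C(i + j, i).

Definition consts sigma : {pred R} := [pred x | sigma x == x%:P].

Variable sigma : {rmorphism R -> {poly R}}.

Lemma constsP x : reflect (sigma x = x%:P) (x \in consts sigma).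
Proof. by rewrite inE; apply: eqP. Qed.

Fact consts_divring_closed : divring_closed (consts sigma).
Proof.
split=> [|x y /constsP sx /constsP sy|x y /constsP sx /constsP sy]; apply/constsP.
- by rewrite rmorph1.
- by rewrite rmorphB /= sx sy polyCB.
- have [yU|yU] := boolP (y \is a GRing.unit).
    by rewrite rmorphM rmorphV //= sx sy polyCV polyCM.
  by rewrite invr_out // rmorphM /= sx sy polyCM.
Qed.
HB.instance Definition _ := GRing.isDivringClosed.Build R (consts sigma)
  consts_divring_closed.

Definition const_ring : Type := {x : R | x \in consts sigma}.

HB.instance Definition _ := Choice.on const_ring.
HB.instance Definition _ := SubChoice.on const_ring.
HB.instance Definition _ :=
  [SubChoice_isSubIntegralDomain of const_ring by <:].

Definition const_val (c : const_ring) : R := \val c.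

HB.instance Definition _ := GRing.RMorphism.copy const_val \val.

Lemma const_valP (c : const_ring) : sigma (const_val c) = (const_val c)%:P.
Proof. exact/constsP/(valP c). Qed.

Lemma const_val_inj : injective const_val.
Proof. exact: val_inj. Qed.

Lemma consts_lift x : x \in consts sigma -> exists c, x = const_val c.
Proof. by move=> xC; exists (Sub x xC). Qed.

Hypothesis sigma0 : at_zero sigma.

Lemma sigma_eq0 x : (sigma x == 0) = (x == 0).
Proof.
apply/eqP/eqP => [sx|->]; last exact: rmorph0.
by rewrite -(sigma0 x) sx coef0.
Qed.

Lemma size_sigma_gt0 x : (0 < size (sigma x))%N = (x != 0).
Proof. by rewrite size_poly_gt0 sigma_eq0. Qed.

Lemma consts_size x : (x \in consts sigma) = (size (sigma x) <= 1)%N.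
Proof.
apply/constsP/idP => [->|/size1_polyC ->]; first exact: size_polyC_leq1.
by rewrite sigma0.
Qed.

(** The degree in [U] is additive on products in a domain. *)
Lemma consts_factor x y :
  x != 0 -> y != 0 -> x * y \in consts sigma -> x \in consts sigma.
Proof.
rewrite -!sigma_eq0 !consts_size rmorphM => x0 y0; rewrite size_mul //.
by move: x0 y0; rewrite -!size_poly_gt0; lia.
Qed.

Lemma unit_consts x : x \is a GRing.unit -> x \in consts sigma.
Proof.
move=> xU; apply: (@consts_factor x x^-1); rewrite ?divrr ?rpred1 //.
  by apply: contraTneq xU => ->; rewrite unitr0.
by apply: contraTneq xU => x0; rewrite -[x]invrK x0 invr0 unitr0.
Qed.

Lemma const_ring_factor (c : const_ring) x y :
  const_val c != 0 -> const_val c = x * y -> exists a, x = const_val a.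
Proof.
move=> c0 cE; apply: consts_lift; apply: (@consts_factor x y).
- by apply: contra_neq c0 => x0; rewrite cE x0 mul0r.
- by apply: contra_neq c0 => y0; rewrite cE y0 mulr0.
- by rewrite -cE (valP c).
Qed.

Lemma const_ring_unit (c : const_ring) :
  (const_val c \is a GRing.unit) = (c \is a GRing.unit).
Proof.
apply/idP/idP => [cU|]; last exact: rmorph_unit.
have [|d dE] := consts_lift (unit_consts (x := (const_val c)^-1) _).
  by rewrite unitrV.
by apply/unitrP; exists d; split; apply: const_val_inj;
  rewrite rmorphM rmorph1 /= -dE ?mulVr ?divrr.
Qed.

(** All prime factors of a constant are constants, and divisibility between
    constants is the same in [R]. *)
Lemma ufd_const_ring : ufd R -> ufd const_ring.
Proof.
move=> facR c c0.
have vc0 : const_val c != 0 by rewrite -(rmorph0 const_val) (inj_eq const_val_inj).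
have [u [s [uU sP cE]]] := facR _ vc0.
have [u' u'E] := const_ring_factor vc0 cE.
have [s' s'E] : exists s', s = map const_val s'.
  have : {in s, forall p, exists a, p = const_val a}.
    move=> p ps; have := cE; rewrite (big_rem p) //= mulrCA.
    exact: const_ring_factor.
  elim: (s) => [|p r IHr] H; first by exists [::].
  have [|r' ->] := IHr; first by move=> q qr; apply: H; rewrite in_cons qr orbT.
  by have [a ->] := H p (mem_head _ _); exists (a :: r').
exists u', s'; split.
- by rewrite -const_ring_unit -u'E.
- move=> p ps; have [|p0 pU pM] := sP (const_val p).
    by rewrite s'E map_f.
  split; first by apply: contra_neq p0 => ->; rewrite rmorph0.
    by rewrite -const_ring_unit.
  have down a : divides (const_val p) (const_val a) -> divides p a.
    have [->|a0] := eqVneq a 0; first by exists 0; rewrite mul0r.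
    case=> z zE; have [|b bE] := const_ring_factor _ zE.
      by rewrite -(rmorph0 const_val) (inj_eq const_val_inj).
    by exists b; apply: const_val_inj; rewrite rmorphM /= -bE.
  move=> a b [z zE]; case: (pM (const_val a) (const_val b)).
  + by exists (const_val z); rewrite -!rmorphM zE.
  + by move/down; left.
  + by move/down; right.
- by apply: const_val_inj; rewrite cE rmorphM rmorph_prod /= u'E s'E big_map.
Qed.

End Constants.
Arguments const_val {R} sigma c.

Section LocalSlice.
Variables (R : idomainType) (sigma : {rmorphism R -> {poly R}}).
Hypotheses (sigma0 : at_zero sigma) (sigmaD : exp_law sigma).
Implicit Types x y s : R.

Definition sdeg x : nat := (size (sigma x)).-1.

Lemma sdegS x : x != 0 -> size (sigma x) = (sdeg x).+1.
Proof. by rewrite -(size_sigma_gt0 sigma0) /sdeg => /prednK. Qed.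

Lemma sdeg_gt0 x : (0 < sdeg x)%N = (x \notin consts sigma).
Proof. by rewrite (consts_size sigma0) /sdeg; lia. Qed.

Lemma lead_sigma_const x : lead_coef (sigma x) \in consts sigma.
Proof.
apply/constsP/polyP => i; rewrite coefC lead_coefE sigmaD.
case: i => [|i]; first by rewrite bin0 mulr1n.
by rewrite nth_default ?mul0rn // addSnnS (leq_trans (leqSpred _)) // leq_addl.
Qed.

Lemma sdeg_mul x y : x != 0 -> y != 0 -> sdeg (x * y) = (sdeg x + sdeg y)%N.
Proof.
rewrite -!(sigma_eq0 sigma0) /sdeg => x0 y0; rewrite rmorphM size_mul //.
by move: x0 y0; rewrite -!size_poly_gt0; lia.
Qed.

Definition minimal_slice s : Prop :=
  s \notin consts sigma /\
  forall y, y \notin consts sigma -> (sdeg s <= sdeg y)%N.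

Lemma minimal_slice_exists :
  (exists x, x \notin consts sigma) -> exists s, minimal_slice s.
Proof.
case=> x; have [n] := ubnP (sdeg x); elim: n x => // n IHn x; rewrite ltnS => le_n xN.
case: (classic (forall y, y \notin consts sigma -> (sdeg x <= sdeg y)%N)).
  by exists x.
case/not_all_ex_not => y Hy; case: (imply_to_and _ _ Hy) => yN /negP.
by rewrite -ltnNge => lt_yx; apply: (IHn y) => //; apply: leq_trans le_n.
Qed.

(** If ['C(m, i)] is nonzero in [R], where [m] is the degree of [x], then the
    coefficient of index [m - i] of [sigma x] has degree exactly [i], which is
    positive and below the minimum. *)
Lemma bin_eq0_lt_min s x i : minimal_slice s -> x != 0 ->
  (0 < i < sdeg s)%N -> ('C(sdeg x, i))%:R = 0 :> R.
Proof.
case=> _ sM x0 /andP[i0 lt_i].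
have [lt_xi|le_ix] := ltnP (sdeg x) i; first by rewrite bin_small.
apply/eqP; apply: contraTT isT => nz.
pose y := (sigma x)`_(sdeg x - i).
have yE j : (sigma y)`_j = (sigma x)`_(j + (sdeg x - i)) *+ 'C(j + (sdeg x - i), j).
  exact: sigmaD.
have szy : size (sigma y) = i.+1.
  apply/eqP; rewrite eqn_leq; apply/andP; split.
    apply/leq_sizeP => j lt_ij; rewrite yE nth_default ?mul0rn //.
    by rewrite sdegS //; lia.
  rewrite ltnNge; apply: contra nz => /leq_sizeP/(_ i (leqnn _)).
  rewrite yE (subnKC le_ix) => E.
  have : lead_coef (sigma x) * ('C(sdeg x, i))%:R == 0 by rewrite mulr_natr E.
  by rewrite mulf_eq0 lead_coef_eq0 (sigma_eq0 sigma0) (negPf x0).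
have := sM y; rewrite (consts_size sigma0) szy /sdeg szy /= -ltnNge ltnS.
by move=> /(_ i0); rewrite -/(sdeg s); lia.
Qed.

(** Modulo [X ^ n], where [n] is the minimal positive degree, one has
    [(1 + X) ^ m = 1] for every degree [m], in particular for [m = n]; hence
    also for the remainder of [m] modulo [n], which must then vanish. *)
Lemma minimal_sdeg_dvd s x : minimal_slice s -> x != 0 -> (sdeg s %| sdeg x)%N.
Proof.
move=> sM x0; set n := sdeg s; set m := sdeg x.
have sN : s \notin consts sigma by case: sM.
have n0 : (0 < n)%N by rewrite sdeg_gt0.
have s0 : s != 0 by apply: contraNneq sN => ->; rewrite rpred0.
have coef1X d i : ((1 + 'X : {poly R}) ^+ d)`_i = ('C(d, i))%:R.
  rewrite exprDn coef_sum; have [le_id|lt_di] := leqP i d; last first.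
    rewrite bin_small // big1 // => j _.
    rewrite expr1n mul1r coefMn coefXn (_ : i == j = false) ?mul0rn //.
    by have := ltn_ord j; apply: contraTF => /eqP <-; rewrite -leqNgt.
  rewrite (bigD1 (Ordinal (le_id : i < d.+1)%N)) //= expr1n mul1r coefMn coefXn eqxx.
  rewrite big1 ?addr0 // => j; rewrite -val_eqE /= => ne_ji.
  by rewrite expr1n mul1r coefMn coefXn eq_sym (negPf ne_ji) mul0rn.
have [q qE] : exists q : {poly R}, (1 + 'X) ^+ n = 1 + 'X^n * q.
  exists 1; apply/polyP => i; rewrite coef1X mulr1 coefD coef1 coefXn.
  have [->|i0] := posnP i; first by rewrite bin0 (ltn_eqF n0) addr0.
  rewrite mulr0n add0r.
  have [lt_in|lt_ni|->] := ltngtP i n.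
  - by rewrite (@bin_eq0_lt_min s s) ?i0 //.
  - by rewrite bin_small.
  - by rewrite binn.
have [w wE] : exists w : {poly R}, (1 + 'X) ^+ (n * (m %/ n)) = 1 + 'X^n * w.
  rewrite exprM qE; elim: (m %/ n)%N => [|d [w IH]]; first by exists 0; rewrite mulr0 addr0.
  by exists (q + w + 'X^n * q * w); rewrite exprS IH; ring.
rewrite /dvdn; apply/negPn/negP; rewrite -lt0n => r0.
have lt_r : (m %% n < n)%N by rewrite ltn_mod.
have : ((1 + 'X : {poly R}) ^+ m)`_(m %% n) = 1.
  rewrite {1}(divn_eq m n) [(_ * n)%N]mulnC exprD wE mulrDl mul1r coefD coef1X binn.
  by rewrite -mulrA coefXnM lt_r addr0.
rewrite coef1X (@bin_eq0_lt_min s x) ?r0 // => /esym/eqP.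
by rewrite oner_eq0.
Qed.

Lemma sigma_peval s (Q : {poly const_ring sigma}) :
  sigma (peval (const_val sigma) s Q) =
  map_poly (const_val sigma) Q \Po sigma s.
Proof.
rewrite peval_comp.
apply: (poly_hom_ext (f := peval _ _)
  (g := comp_poly (sigma s) \o map_poly (const_val sigma))) => /= [c|].
  by rewrite pevalC map_polyC /= comp_polyC const_valP.
by rewrite pevalX map_polyX comp_polyX.
Qed.

Lemma peval_slice_eq0 s (Q : {poly const_ring sigma}) :
  s \notin consts sigma -> peval (const_val sigma) s Q = 0 -> Q = 0.
Proof.
move=> sN Q0; apply: (map_inj_poly (@const_val_inj _ sigma)); rewrite ?rmorph0 //.
apply/eqP; rewrite -(@comp_poly_eq0 _ _ (sigma s)); last first.
  by rewrite ltnNge -(consts_size sigma0).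
by rewrite -sigma_peval Q0 rmorph0.
Qed.

(** After multiplication by a power of the leading coefficient of [sigma s],
    the leading term of [sigma x] is that of a constant times a power of [s]. *)
Lemma slice_generates s x : minimal_slice s -> exists c Q,
  c != 0 /\ const_val sigma c * x = peval (const_val sigma) s Q.
Proof.
move=> sM; have [sN _] := sM.
have s0 : s != 0 by apply: contraNneq sN => ->; rewrite rpred0.
have [b bE] := consts_lift (lead_sigma_const s).
have b0 : b != 0.
  apply: contra_neq s0 => b0; apply/eqP; rewrite -(sigma_eq0 sigma0) -lead_coef_eq0.
  by rewrite bE b0 rmorph0.
have [n] := ubnP (size (sigma x)); elim: n x => // n IHn x; rewrite ltnS => le_n.
have [->|x0] := eqVneq x 0.
  by exists 1, 0; rewrite oner_eq0 mulr0 rmorph0.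
have [xC|xN] := boolP (x \in consts sigma).
  have [c ->] := consts_lift xC.
  by exists 1, c%:P; rewrite oner_eq0 rmorph1 mul1r pevalC.
have [a aE] := consts_lift (lead_sigma_const x).
have [d dE] := dvdnP (minimal_sdeg_dvd sM x0).
have [|c [Q [c0 QE]]] :=
    IHn (const_val sigma (b ^+ d) * x - const_val sigma a * s ^+ d).
  apply: leq_trans le_n.
  have szx := sdegS x0.
  rewrite szx ltnS; apply/leq_sizeP => j le_j.
  rewrite rmorphB !rmorphM [sigma (s ^+ d)]rmorphXn !const_valP coefB !coefCM.
  have szs : (size (sigma s ^+ d)).-1 = sdeg x by rewrite size_exp dE mulnC.
  have [->|ne_j] := eqVneq j (sdeg x).
    have -> : (sigma x)`_(sdeg x) = const_val sigma a by rewrite -aE lead_coefE.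
    by rewrite -szs -lead_coefE lead_coef_exp bE rmorphXn mulrC subrr.
  have lt_j : (sdeg x < j)%N by rewrite ltn_neqAle eq_sym ne_j.
  rewrite [(sigma x)`_j]nth_default ?szx // mulr0.
  rewrite nth_default ?mulr0 ?subrr //.
  by apply: leq_trans (leqSpred _) _; rewrite szs.
exists (c * b ^+ d), (Q + (c * a)%:P * 'X^d); split.
  by rewrite mulf_neq0 ?expf_neq0.
rewrite rmorphD /= -QE [peval _ _ (_ * _)]rmorphM /= pevalC pevalXn !rmorphM /=; ring.
Qed.

End LocalSlice.

(** * Retracts that are rings of constants *)

Lemma sdeg_sub_const (B : idomainType) (sigma : {rmorphism B -> {poly B}})
    (sigma0 : at_zero sigma) b c :
  c \in consts sigma -> (sdeg sigma (b - c) <= sdeg sigma b)%N.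
Proof.
move=> cC; have [bC|bN] := boolP (b \in consts sigma).
  rewrite (_ : sdeg sigma (b - c) = 0%N) //; apply/eqP; rewrite -leqn0 leqNgt.
  by rewrite (sdeg_gt0 sigma0) rpredB.
rewrite /sdeg rmorphB /= (constsP _ _ cC).
have sz : (0 < (size (sigma b)).-1)%N by rewrite [(_ < _)%N]sdeg_gt0.
rewrite -!subn1 leq_sub2r //; apply: leq_trans (size_polyD _ _) _.
rewrite geq_max leqnn size_polyN (leq_trans (size_polyC_leq1 _)) //.
by case: (size _) sz.
Qed.

Section Retract.
Variables (B : idomainType) (sigma : {rmorphism B -> {poly B}}).
Variable phi : {rmorphism B -> B}.
Hypotheses (facB : ufd B) (sigma0 : at_zero sigma) (sigmaD : exp_law sigma).
Hypothesis phi_in : forall x, phi x \in consts sigma.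
Hypothesis phi_id : forall x, x \in consts sigma -> phi x = x.
Local Notation val := (const_val sigma).

(** The kernel of [phi] contains a minimal slice, hence a prime factor [t] of
    one, which is again a minimal slice. A multiple of each element of the
    kernel by a nonzero constant is a polynomial in [t] without constant term;
    as [t] is prime and divides no nonzero constant, [t] generates the kernel. *)
Lemma kernel_principal : (exists x, x \notin consts sigma) ->
  exists2 t, minimal_slice sigma t & forall b, phi b = 0 -> divides t b.
Proof.
case/(minimal_slice_exists) => s0 [s0N s0M].
pose s := s0 - phi s0.
have phis : phi s = 0 by rewrite rmorphB (phi_id (phi_in s0)) subrr.
have sN : s \notin consts sigma.
  apply: contra s0N => sC; rewrite -[s0](subrK (phi s0)).
  by rewrite rpredD.
have s_neq0 : s != 0 by apply: contraNneq sN => ->; rewrite rpred0.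
have degs : (sdeg sigma s <= sdeg sigma s0)%N by apply: sdeg_sub_const.
have [u [l [uU lP sE]]] := facB s_neq0.
have [t tl phit] : exists2 t, t \in l & phi t = 0.
  have : phi (\prod_(p <- l) p) = 0.
    have : phi u * phi (\prod_(p <- l) p) = 0 by rewrite -rmorphM -sE.
    have phiU : phi u != 0.
      by apply: contraTneq (rmorph_unit phi uU) => ->; rewrite unitr0.
    by move/eqP; rewrite mulf_eq0 (negPf phiU) => /eqP.
  move/eqP; rewrite rmorph_prod prodf_seq_eq0 => /hasP[t tl /eqP phit].
  by exists t.
have [t0 tU tM] := lP t tl.
have tN : t \notin consts sigma.
  by apply: contra t0 => /phi_id; rewrite phit => <-.
have dvd_ts : divides t s.
  by rewrite sE (big_rem t) //=; apply/dvd_mull/dvd_mulr/dvd_refl.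
have tmin : minimal_slice sigma t.
  split=> // y yN; apply: leq_trans (s0M y yN); apply: leq_trans degs.
  case: dvd_ts => z zE; rewrite zE sdeg_mul ?leq_addl //.
  by apply: contra_neq s_neq0 => z0; rewrite zE z0 mul0r.
exists t => // b phib.
have [c [Q [c0 QE]]] := slice_generates sigma0 sigmaD b tmin.
have Q0 : Q`_0 = 0.
  have : phi (val c * b) = 0 by rewrite rmorphM phib mulr0.
  rewrite QE peval_comp phit peval_at0 /= phi_id ?(valP Q`_0) //.
  by rewrite -(rmorph0 val) => /const_val_inj.
have : divides t (val c * b).
  have [Q' Q'E] := polyX_factor Q0; exists (peval val t Q').
  by rewrite QE Q'E rmorphM /= pevalX.
case/tM => // -[z zE].
have : phi (val c) = 0 by rewrite zE rmorphM phit mulr0.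
rewrite phi_id ?(valP c) // => /eqP.
by rewrite -(rmorph0 val) (inj_eq (@const_val_inj _ _)) (negPf c0).
Qed.

(** The quotient of [b - phi b] by [t] has smaller degree than [b]. *)
Theorem retract_polynomial_ring : (exists x, x \notin consts sigma) ->
  exists t, (forall b, exists Q, b = peval val t Q) /\
            (forall Q, peval val t Q = 0 -> Q = 0).
Proof.
case/kernel_principal => t tmin tdvd; have [tN _] := tmin.
exists t; split=> [b|Q]; last exact: peval_slice_eq0.
have [n] := ubnP (sdeg sigma b); elim: n b => // n IHn b; rewrite ltnS => le_n.
have [c cE] := consts_lift (phi_in b).
have [z zE] : divides t (b - phi b).
  by apply: tdvd; rewrite rmorphB (phi_id (phi_in b)) subrr.
have [bC|bN] := boolP (b \in consts sigma).
  by exists c%:P; rewrite pevalC /= -cE phi_id.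
have [z0|z0] := eqVneq z 0.
  by exists c%:P; move/eqP: zE; rewrite z0 mul0r subr_eq0 pevalC /= -cE => /eqP.
have t0 : t != 0 by apply: contraNneq tN => ->; rewrite rpred0.
have [|Q QE] := IHn z.
  apply: leq_trans le_n.
  have : sdeg sigma (b - phi b) = (sdeg sigma z + sdeg sigma t)%N by rewrite zE sdeg_mul.
  have : (sdeg sigma (b - phi b) <= sdeg sigma b)%N by apply: sdeg_sub_const.
  have : (0 < sdeg sigma t)%N by rewrite sdeg_gt0.
  lia.
exists (Q * 'X + c%:P).
by rewrite rmorphD /= [peval _ _ (_ * _)]rmorphM /= pevalX pevalC /= -QE -zE -cE subrK.
Qed.

End Retract.

(** * Factorial subrings of a polynomial ring in one variable *)

Lemma base_expansion (k : fieldType) (w h : {poly k}) : (1 < size w)%N ->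
  exists2 W : {poly {poly k}}, (size W <= (size w).-1)%N &
    h = \sum_(i < (size w).-1) (W`_i \Po w) * 'X^i.
Proof.
move=> w1; have [n] := ubnP (size h); elim: n h => // n IHn h; rewrite ltnS => le_n.
have w0 : w != 0 by rewrite -size_poly_gt0 ltnW.
have [->|h0] := eqVneq h 0.
  exists 0; first by rewrite size_poly0.
  by rewrite big1 // => i _; rewrite coef0 comp_poly0 mul0r.
have [|W sW hE] := IHn (h %/ w).
  rewrite size_divp //; apply: leq_trans le_n.
  by rewrite ltn_subrL size_poly_gt0 h0 andbT -ltnS prednK // ltnW.
exists (\poly_(i < (size w).-1) ('X * W`_i + ((h %% w)`_i)%:P)); first exact: size_poly.
rewrite {1}(Pdiv.Field.divp_eq h w).
have sr : (size (h %% w)%R <= (size w).-1)%N.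
  by rewrite -ltnS prednK ?ltn_modp // ltnW.
have rE : h %% w = \sum_(i < (size w).-1) ((h %% w)`_i)%:P * 'X^i.
  rewrite -{1}[h %% w]coefK poly_def (big_ord_widen _ (fun i => (h %% w)`_i *: 'X^i) sr).
  rewrite big_mkcond /=; apply: eq_bigr => i _; rewrite mul_polyC.
  by case: ltnP => // le_i; rewrite nth_default ?scale0r.
rewrite {1}hE {1}rE mulr_suml -big_split /=; apply: eq_bigr => i _.
rewrite coef_poly ltn_ord comp_polyD comp_polyM comp_polyX comp_polyC; ring.
Qed.

Section Luroth.
Variables (k : fieldType) (C : idomainType) (iota : {rmorphism k -> C}).
Variable psi : {rmorphism C -> {poly k}}.
Hypotheses (facC : ufd C) (psi_inj : injective psi).
Hypothesis psi_iota : forall a, psi (iota a) = a%:P.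

Local Notation ev := (peval psi 'X).

Lemma ev_iota (P : {poly k}) : ev (map_poly iota P) = P.
Proof.
apply: (poly_hom_ext (f := peval psi 'X \o map_poly iota) (g := idfun)) => /= [c|].
  by rewrite map_polyC pevalC /= psi_iota.
by rewrite map_polyX pevalX.
Qed.

Lemma size_psi c : (forall a, c != iota a) -> (1 < size (psi c))%N.
Proof.
move=> cN; rewrite ltnNge; apply/negP => /size1_polyC E.
by have /eqP[] := cN (psi c)`_0; apply: psi_inj; rewrite psi_iota.
Qed.

Lemma size_psi_gt0 c : c != 0 -> (0 < size (psi c))%N.
Proof. by rewrite size_poly_gt0 -(rmorph0 psi) (inj_eq psi_inj). Qed.

Lemma ev_graph c : ev (map_poly iota (psi c) - c%:P) = 0.
Proof. by rewrite rmorphB /= ev_iota pevalC subrr. Qed.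

Lemma size_graph c : (forall a, c != iota a) ->
  size (map_poly iota (psi c) - c%:P) = size (psi c).
Proof.
move=> /size_psi sz.
have szm : size (map_poly iota (psi c)) = size (psi c).
  by apply: size_map_inj_poly; [apply: fmorph_inj | apply: rmorph0].
by rewrite size_polyDl szm // size_polyN (leq_ltn_trans (size_polyC_leq1 _)).
Qed.

(** A prime [m] with [ev m = 0] is, up to a unit, the minimal polynomial of the
    variable over [C]: if [Q] has least degree among the polynomials killed by
    [ev], pseudo-division gives [c * m = q * Q], and [m] divides neither factor. *)
Lemma ev_small_eq0 m Q : prime_elt m -> ev m = 0 -> ev Q = 0 ->
  (size Q < size m)%N -> Q = 0.
Proof.
case=> m0 _ mM evm; have [n] := ubnP (size Q); elim: n Q => // n IHn Q.
rewrite ltnS => le_n evQ lt_Qm; apply/eqP; apply: contraTT isT => Q0.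
have /= E := Pdiv.Idomain.divp_eq m Q; set c := lead_coef Q ^+ _ in E.
have c0 : c != 0 by rewrite expf_neq0 // lead_coef_eq0.
have lt_r := Pdiv.Idomain.ltn_modpN0 m Q0.
have r0 : (m %% Q)%R = 0.
  apply: IHn; first exact: leq_trans le_n.
  - have : ev (c *: m) = ev (m %/ Q) * ev Q + ev (m %% Q).
      by rewrite E rmorphD rmorphM.
    by rewrite pevalZ evm evQ !mulr0 add0r.
  - exact: ltn_trans lt_r lt_Qm.
have [] := mM (m %/ Q)%R Q.
- by exists c%:P; rewrite mul_polyC E r0 addr0.
- case=> z zE; move: E; rewrite r0 addr0 zE -mul_polyC => E.
  have : c%:P = z * Q by apply: (mulIf m0); rewrite E; ring.
  move/(congr1 (peval psi 'X)); rewrite rmorphM /= evQ mulr0 pevalC => /eqP.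
  by rewrite -size_poly_eq0 -leqn0 leqNgt size_psi_gt0.
- case=> z zE; move: lt_Qm; rewrite zE size_mul //.
  + have : z != 0 by apply: contra_neq Q0 => z0; rewrite zE z0 mul0r.
    by rewrite -size_poly_gt0 => ? ?; lia.
  + by apply: contra_neq Q0 => z0; rewrite zE z0 mul0r.
Qed.

Lemma ev_prime g : (forall a, g != iota a) ->
  exists m, [/\ prime_elt m, ev m = 0 & lead_coef m \is a GRing.unit].
Proof.
move=> gN; set G := map_poly iota (psi g) - g%:P.
have G0 : G != 0 by rewrite -size_poly_gt0 size_graph // ltnW // size_psi.
have lG : lead_coef G \is a GRing.unit.
  rewrite lead_coefDl; last first.
    rewrite size_polyN size_map_inj_poly ?rmorph0 //; last exact: fmorph_inj.
    exact: leq_ltn_trans (size_polyC_leq1 _) (size_psi gN).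
  rewrite lead_coef_map_inj ?rmorph0 //; last exact: fmorph_inj.
  rewrite rmorph_unit // unitfE lead_coef_eq0 -size_poly_gt0 ltnW //.
  exact: size_psi.
have [u [s [uU sP GE]]] := ufd_poly facC G0.
have [m ms evm] : exists2 m, m \in s & ev m = 0.
  have evu : ev u != 0.
    have evuU : ev u \is a GRing.unit by apply: rmorph_unit.
    by apply: contraTneq evuU => ->; rewrite unitr0.
  have := ev_graph g; rewrite -/G GE rmorphM /= => /eqP.
  rewrite mulf_eq0 (negPf evu) /= rmorph_prod prodf_seq_eq0 => /hasP[m ms /eqP].
  by exists m.
exists m; split=> //; first exact: sP.
move: lG; rewrite GE (big_rem m) //= lead_coefM lead_coefM unitrM => /andP[_].
by rewrite unitrM => /andP[].
Qed.

(** Lüroth's theorem in its polynomial form. Let [m] be the minimal polynomial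
    of the variable over [C], and [f] a non-constant coefficient of [m], of
    degree [d]. Then [m] divides [f(X) - f], and comparing degrees in the two
    variables shows that the cofactor is constant. So [m] has degree [d] in
    [X], while every element of [C] has an [f]-adic expansion of degree below
    [d] in the variable; minimality of [m] forces that expansion to be
    constant. *)
Theorem luroth : (exists g, forall a, g != iota a) -> exists f,
  (forall a, f != iota a) /\ (forall c, exists P, c = peval iota f P).
Proof.
case=> g /ev_prime[m [mP evm lmU]].
have m0 : m != 0 by case: mP.
have [j fN] : exists j, forall a, m`_j != iota a.
  apply: NNPP => H; case/eqP: m0.
  have mk i : m`_i = iota (psi m`_i)`_0.
    apply: NNPP => mi; apply: H; exists i => a; apply: contra_notN mi => /eqP ->.
    by rewrite psi_iota coefC eqxx.
  have mE : m = map_poly iota (\poly_(i < size m) (psi m`_i)`_0).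
    apply/polyP => i; rewrite coef_map coef_poly /=; case: ltnP => [lt_i|le_i].
      exact: mk.
    by rewrite nth_default // rmorph0.
  by rewrite mE -[X in map_poly _ X]ev_iota -mE evm rmorph0.
pose f := m`_j; pose F := map_poly iota (psi f) - f%:P.
pose d := (size (psi f)).-1.
have szf : size (psi f) = d.+1 by rewrite /d prednK // ltnW // size_psi.
have d0 : (0 < d)%N by have := size_psi fN; rewrite -/f szf.
have [q FE] : exists q, F = q * m.
  exists (F %/ m)%R.
  have E := Pdiv.IdomainUnit.divp_eq lmU F.
  suff r0 : (F %% m)%R = 0 by rewrite {1}E r0 addr0.
  apply: (ev_small_eq0 mP evm); last by rewrite Pdiv.Idomain.ltn_modp.
  have : ev F = ev (F %/ m) * ev m + ev (F %% m) by rewrite {1}E rmorphD rmorphM.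
  by rewrite ev_graph evm mulr0 add0r.
have szm : (d < size m)%N.
  have mapF : map_poly psi F = map_poly psi q * map_poly psi m by rewrite FE rmorphM.
  have := congr1 (@swapXY k) mapF; rewrite rmorphM.
  have -> : map_poly psi F = map_poly polyC (psi f) - (psi f)%:P.
    rewrite rmorphB /= map_polyC -map_poly_comp; congr (_ - _).
    by apply: eq_map_poly => a /=; rewrite psi_iota.
  rewrite rmorphB /= swapXY_map_polyC swapXY_polyC => E.
  set M := swapXY (map_poly psi m) in E; set Q := swapXY (map_poly psi q) in E.
  have szFF : size ((psi f)%:P - map_poly polyC (psi f)) = d.+1.
    rewrite addrC size_polyDl size_polyN size_map_polyC szf //.
    by apply: leq_ltn_trans (size_polyC_leq1 _) _.
  have leadFF : lead_coef ((psi f)%:P - map_poly polyC (psi f)) = - (lead_coef (psi f))%:P.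
    have lP : lead_coef (map_poly polyC (psi f)) = (lead_coef (psi f))%:P.
      by apply: lead_coef_map_inj; [apply: polyC_inj | apply: polyC0].
    rewrite addrC lead_coefDl; first by rewrite lead_coefN lP.
    rewrite size_polyN size_map_polyC szf.
    exact: leq_ltn_trans (size_polyC_leq1 _) _.
  have leM : (d < size M)%N.
    rewrite ltnNge; apply/negP => /leq_sizeP/(_ d (leqnn _))/(congr1 (fun p : {poly k} => p`_j)).
    rewrite coef_swapXY coef0 coef_map /= => /eqP.
    rewrite -/f (_ : (psi f)`_d = lead_coef (psi f)) // lead_coef_eq0 -size_poly_eq0.
    by rewrite szf.
  have M0 : M != 0 by rewrite -size_poly_gt0 (leq_ltn_trans _ leM).
  have Q0 : Q != 0 by apply/negP => /eqP Q0; move: szFF; rewrite E Q0 mul0r size_poly0.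
  have szQ : size Q = 1%N.
    have sum_eq a b : (0 < a)%N -> (d < b)%N -> (a + b).-1 = d.+1 -> a = 1%N by lia.
    by move: szFF; rewrite E size_mul //; apply: sum_eq leM; rewrite size_poly_gt0.
  have [h QE] : exists h, Q = h%:P by exists Q`_0; apply: size1_polyC; rewrite szQ.
  have szh : (size h <= 1)%N.
    move: leadFF; rewrite E lead_coefM QE lead_coefC => E'.
    have : size (- (lead_coef (psi f))%:P) = 1%N.
      by rewrite size_polyN size_polyC lead_coef_eq0 -size_poly_gt0 szf.
    rewrite -E' size_mul ?lead_coef_eq0 //; last by move: Q0; rewrite QE polyC_eq0.
    have sum_le a b : (0 < b)%N -> (a + b).-1 = 1%N -> (a <= 1)%N by lia.
    by apply: sum_le; rewrite size_poly_gt0 lead_coef_eq0.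
  have szq : (size q <= 1)%N.
    rewrite -(size_map_inj_poly psi_inj) ?rmorph0 //.
    rewrite -[map_poly psi q]swapXYK -/Q QE swapXY_polyC size_map_polyC //.
  have : size F = d.+1 by rewrite size_graph.
  have q0 : q != 0.
    by apply: contra_neq Q0 => q0; rewrite /Q q0 rmorph0 raddf0.
  rewrite FE size_mul //.
  have sum_lt a b : (a <= 1)%N -> (a + b).-1 = d.+1 -> (d < b)%N by lia.
  exact: sum_lt.
exists f; split=> // c.
have [W szW cE] := base_expansion (psi c) (size_psi fN).
exists W`_0.
pose Z := map_poly (peval iota f) W - c%:P.
have : Z = 0.
  apply: (ev_small_eq0 mP evm).
    rewrite rmorphB /= pevalC cE; apply/eqP; rewrite subr_eq0; apply/eqP.
    rewrite (@peval_wide _ _ _ _ d); last first.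
      by apply: leq_trans szW; apply: size_poly.
    apply: eq_bigr => i _; rewrite coef_map /= peval_comp; congr (_ * _).
    apply: (poly_hom_ext (f := peval _ _) (g := comp_poly (psi f))) => /= [a|].
      by rewrite pevalC /= psi_iota comp_polyC.
    by rewrite pevalX comp_polyX.
  apply: leq_ltn_trans szm; apply: leq_trans (size_polyD _ _) _.
  rewrite geq_max size_polyN (leq_trans (size_polyC_leq1 _)) // andbT.
  by apply: leq_trans szW; apply: size_poly.
move/(congr1 (fun p : {poly C} => p`_0)); rewrite coefB coef_map coefC coef0 /= => /eqP.
by rewrite subr_eq0 => /eqP.
Qed.

End Luroth.

(** * Exponential maps on a polynomial ring over [A] descend to [A] *)

Lemma coef_top_mul (R : idomainType) (p q : {poly R}) m n :
  (size p <= m.+1)%N -> (size q <= n.+1)%N -> (p * q)`_(m + n) = p`_m * q`_n.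
Proof.
move=> le_p le_q; rewrite coefM.
have lt_m : (m < (m + n).+1)%N by rewrite ltnS leq_addr.
rewrite (bigD1 (Ordinal lt_m)) //= addKn big1 ?addr0 // => -[i lt_i].
rewrite -val_eqE /= => ne_im.
have [lt_im|le_mi] := ltnP i m.
  by rewrite [q`__]nth_default ?mulr0 //; apply: leq_trans le_q _; lia.
by rewrite [p`__]nth_default ?mul0r //; apply: leq_trans le_p _; lia.
Qed.

Section LeadingForms.
Variables (A : idomainType) (tau : {rmorphism {poly A} -> {poly {poly A}}}).
Hypotheses (tau0 : at_zero tau) (tauD : exp_law tau).
Variables (nu rho : nat).
Hypothesis nu_gt0 : (0 < nu)%N.
Implicit Types (p q : {poly A}) (a : A) (w i j : nat).

(** Give the variable [t] of [{poly A}] weight [nu] and [U] weight [- rho]. To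
    avoid fractional exponents, [t] is replaced by [t ^ nu]. *)
Definition scaled p i : {poly A} := (tau p)`_i \Po 'X^nu.

Definition weight_le p w : Prop :=
  forall i, (size (scaled p i) <= (w + rho * i).+1)%N.

(** The component of weight [w] of [tau p], evaluated at [t = 1]. *)
Definition lead_form p w : {poly A} :=
  \poly_(i < size (tau p)) (scaled p i)`_(w + rho * i).

Lemma coef_lead_form p w i : (lead_form p w)`_i = (scaled p i)`_(w + rho * i).
Proof.
rewrite coef_poly; case: ltnP => // le_i.
by rewrite /scaled [(tau p)`__]nth_default // comp_poly0 coef0.
Qed.

Lemma scaledD p q i : scaled (p + q) i = scaled p i + scaled q i.
Proof. by rewrite /scaled rmorphD coefD comp_polyD. Qed.

Lemma scaledM p q i :
  scaled (p * q) i = \sum_(j < i.+1) scaled p j * scaled q (i - j).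
Proof.
rewrite /scaled rmorphM coefM rmorph_sum.
by apply: eq_bigr => j _; rewrite rmorphM.
Qed.

Lemma weight_leD p q w : weight_le p w -> weight_le q w -> weight_le (p + q) w.
Proof.
move=> pw qw i; rewrite scaledD; apply: leq_trans (size_polyD _ _) _.
by rewrite geq_max pw qw.
Qed.

Lemma weight_leM p q v w :
  weight_le p v -> weight_le q w -> weight_le (p * q) (v + w).
Proof.
move=> pv qw i; rewrite scaledM; apply: leq_trans (size_sum _ _ _) _.
apply/bigmax_leqP => -[j le_j] _ /=; apply: leq_trans (size_polyMleq _ _) _.
have bound (c d : nat) : (c <= (v + rho * j).+1)%N -> (d <= (w + rho * (i - j)).+1)%N ->
    ((c + d).-1 <= (v + w + rho * i).+1)%N.
  by clear nu_gt0; rewrite ltnS in le_j; rewrite -{2}(subnKC le_j) mulnDr; lia.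
exact: bound.
Qed.

Lemma lead_formD p q w : lead_form (p + q) w = lead_form p w + lead_form q w.
Proof. by apply/polyP => i; rewrite coefD !coef_lead_form scaledD coefD. Qed.

Lemma lead_formM p q v w : weight_le p v -> weight_le q w ->
  lead_form (p * q) (v + w) = lead_form p v * lead_form q w.
Proof.
move=> pv qw; apply/polyP => i; rewrite coef_lead_form scaledM coef_sum coefM.
apply: eq_bigr => -[j le_j] _ /=; rewrite !coef_lead_form -coef_top_mul //.
by clear nu_gt0; rewrite ltnS in le_j; congr (_`__); rewrite -{1}(subnKC le_j) mulnDr; lia.
Qed.

Lemma lead_form_lt p v w : (v < w)%N -> weight_le p v -> lead_form p w = 0.
Proof.
move=> lt_vw pv; apply/polyP => i; rewrite coef_lead_form coef0 nth_default //.
by apply: leq_trans (pv i) _; rewrite ltn_add2r.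
Qed.

Lemma lead_form0 w : lead_form 0 w = 0.
Proof.
by apply/polyP => i; rewrite coef_lead_form /scaled rmorph0 !coef0 comp_poly0 coef0.
Qed.

Lemma weight_le1 : weight_le 1 0.
Proof.
move=> i; rewrite /scaled rmorph1 coef1; case: (i == _).
  by rewrite comp_polyC size_poly1.
by rewrite comp_poly0 size_poly0.
Qed.

Lemma lead_form1 : lead_form 1 0 = 1.
Proof.
apply/polyP => i; rewrite coef_lead_form /scaled rmorph1 !coef1.
case: i => [|i] /=; first by rewrite muln0 comp_polyC coefC.
by rewrite comp_poly0 coef0.
Qed.

Lemma coef0_lead_form p w : (lead_form p w)`_0 = (p \Po 'X^nu)`_w.
Proof. by rewrite coef_lead_form /scaled tau0 muln0 addn0. Qed.

Hypothesis weightA : forall a, weight_le a%:P 0.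
Hypothesis weightX : weight_le 'X nu.

(** The exponential map obtained on [A]. *)
Definition lead_exp a : {poly A} := lead_form a%:P 0.

Fact lead_exp_zmod_morphism : zmod_morphism lead_exp.
Proof.
move=> a b; apply/eqP; rewrite eq_sym subr_eq; apply/eqP.
by rewrite /lead_exp -lead_formD -polyCD subrK.
Qed.

Fact lead_exp_monoid_morphism : monoid_morphism lead_exp.
Proof.
split=> [|a b]; first exact: lead_form1.
by rewrite /lead_exp polyCM -[0%N in LHS]addn0 lead_formM.
Qed.

HB.instance Definition _ := GRing.isZmodMorphism.Build A {poly A} lead_exp
  lead_exp_zmod_morphism.
HB.instance Definition _ := GRing.isMonoidMorphism.Build A {poly A} lead_exp
  lead_exp_monoid_morphism.

Definition lead_exp_morphism : {rmorphism A -> {poly A}} := lead_exp.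

Local Notation E := (lead_form 'X nu).

Lemma weight_monomial a l : weight_le (a%:P * 'X^l) (nu * l).
Proof.
rewrite -[(nu * l)%N]add0n; apply: (weight_leM (weightA a)).
elim: l => [|l IHl]; first by rewrite muln0; apply: weight_le1.
by rewrite exprS mulnS; apply: (weight_leM weightX).
Qed.

Lemma lead_form_monomial a l :
  lead_form (a%:P * 'X^l) (nu * l) = lead_exp a * E ^+ l.
Proof.
have wX m : weight_le 'X^m (nu * m).
  by have := weight_monomial 1 m; rewrite polyC1 mul1r.
rewrite -[(nu * l)%N]add0n (lead_formM (weightA a) (wX l)); congr (_ * _).
elim: l => [|l IHl]; first by rewrite muln0 lead_form1.
by rewrite !exprS mulnS (lead_formM weightX (wX l)) IHl.
Qed.

Lemma lead_form_poly p w : (nu * (size p).-1 <= w)%N ->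
  lead_form p w = lead_exp (p \Po 'X^nu)`_w * E ^+ (w %/ nu).
Proof.
move=> le_w.
have sumE (I : seq nat) (F : nat -> {poly A}) :
    lead_form (\sum_(l <- I) F l) w = \sum_(l <- I) lead_form (F l) w.
  elim: I => [|l I IH]; first by rewrite !big_nil lead_form0.
  by rewrite !big_cons lead_formD IH.
rewrite -{1}[p]coefK poly_def -(big_mkord xpredT (fun l => p`_l *: 'X^l)) sumE.
rewrite coef_comp_poly_Xn //.
have small l : (nu * l < w)%N -> lead_form (p`_l *: 'X^l) w = 0.
  by move=> lt_w; rewrite -mul_polyC (lead_form_lt lt_w) //; apply: weight_monomial.
have [/dvdnP[n nE]|ndv] := boolP (nu %| w)%N; last first.
  rewrite rmorph0 mul0r big_nat big1 // => l /andP[_ lt_l]; apply: small.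
  rewrite ltn_neqAle (contraNneq _ ndv) => [|<-]; last by rewrite dvdn_mulr.
  by apply: leq_trans le_w; rewrite leq_mul2l; apply/orP; right; move: lt_l; lia.
rewrite nE mulnK //; rewrite [(n * nu)%N]mulnC in nE.
have [le_pn|lt_np] := leqP (size p) n.
  rewrite nth_default // rmorph0 mul0r big_nat big1 // => l /andP[_ lt_l].
  by rewrite mulnC -nE; apply: small; rewrite nE ltn_mul2l nu_gt0 (leq_trans lt_l).
have nE' : n.+1 = size p.
  by apply/eqP; rewrite eqn_leq lt_np -ltnS; move: le_w; rewrite nE leq_mul2l; lia.
rewrite -nE' big_nat_recr //= [X in X + _]big_nat big1 ?add0r; last first.
  move=> l /andP[_ lt_l].
  by rewrite mulnC -nE; apply: small; rewrite nE ltn_mul2l nu_gt0.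
by rewrite mulnC -mul_polyC lead_form_monomial.
Qed.

(** The top weight part of the exponential law. The power of [E] comes from the
    power of [t] in the top weight part of the coefficient of [tau p]. *)
Lemma lead_form_law p w j i : weight_le p w ->
  (lead_exp (lead_form p w)`_j * E ^+ ((w + rho * j) %/ nu))`_i =
  (lead_form p w)`_(i + j) *+ 'C(i + j, i).
Proof.
move=> pw; have le_w : (nu * (size ((tau p)`_j)%R).-1 <= w + rho * j)%N.
  have := pw j; rewrite /scaled => le_j.
  have := size_comp_poly (tau p)`_j ('X^nu); rewrite size_polyXn /= mulnC => <-.
  by move: le_j; case: (size _).
rewrite coef_lead_form -lead_form_poly // coef_lead_form /scaled tauD.
by rewrite raddfMn coefMn coef_lead_form /scaled mulnDr; congr ((_ : {poly A})`__ *+ _); lia.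
Qed.

(** In top degree in [U] the law for [t] says that [E ^+ e], for some [e > 0],
    divides a nonzero constant. *)
Lemma lead_formX : E = 1.
Proof.
have E0 : E`_0 = 1.
  by rewrite coef0_lead_form comp_polyX coefXn eqxx.
have nzE : E != 0 by apply: contra_eqN E0 => /eqP ->; rewrite coef0 eq_sym oner_eq0.
set M := (size E).-1; set e := ((nu + rho * M) %/ nu)%N.
have e0 : (0 < e)%N by rewrite divn_gt0 // leq_addr.
have lE : E`_M != 0 by rewrite -lead_coefE lead_coef_eq0.
have prodE : lead_exp E`_M * E ^+ e = (E`_M)%:P.
  apply/polyP => i; rewrite lead_form_law // coefC.
  case: i => [|i] /=; first by rewrite bin0.
  rewrite nth_default ?mul0rn // /M addSn.
  by case: (size E) => // m; rewrite ltnS leq_addl.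
have : size (lead_exp E`_M * E ^+ e) = 1%N by rewrite prodE size_polyC lE.
have lexp0 : lead_exp E`_M != 0.
  apply: contra_neq lE => l0; move: prodE; rewrite l0 mul0r => /esym/eqP.
  by rewrite polyC_eq0 => /eqP.
rewrite size_mul ?expf_neq0 // => sz.
have : (size (E ^+ e)).-1 = 0%N.
  have aux (c d : nat) : (0 < c)%N -> (c + d).-1 = 1%N -> d.-1 = 0%N by lia.
  by apply: aux sz; rewrite size_poly_gt0.
rewrite size_exp => /eqP; rewrite muln_eq0 (gtn_eqF e0) orbF => szE.
by rewrite (size1_polyC (p := E)) ?E0 // -[size _]prednK ?size_poly_gt0 // (eqP szE).
Qed.

Lemma lead_exp_at_zero : at_zero lead_exp_morphism.
Proof. by move=> a; rewrite coef0_lead_form comp_polyC coefC eqxx. Qed.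

Lemma lead_exp_law : exp_law lead_exp_morphism.
Proof.
move=> a i j; rewrite /= /lead_exp -(lead_form_law _ _ (weightA a)).
by rewrite lead_formX expr1n mulr1.
Qed.

End LeadingForms.

Lemma mpoly_image_ind (k : fieldType) n (A : comNzRingType)
    (pi : {rmorphism {mpoly k[n]} -> A}) (P : A -> Prop) :
    (forall x y, P x -> P y -> P (x + y)) ->
    (forall x y, P x -> P y -> P (x * y)) ->
    (forall c, P (pi c%:MP)) -> (forall i, P (pi 'X_i)) ->
  forall p, P (pi p).
Proof.
move=> PD PM PC PX p.
have P0 : P 0 by rewrite -(rmorph0 pi) -(mpolyC0 n k).
have P1 : P 1 by rewrite -(rmorph1 pi) -(mpolyC1 n k).
rewrite [p]mpolyE rmorph_sum; apply: (big_ind P P0 PD) => m _ /=.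
rewrite -mul_mpolyC rmorphM; apply: (PM); first exact: PC.
rewrite mpolyXE_id rmorph_prod; apply: (big_ind P P1 PM) => i _ /=.
by rewrite rmorphXn; elim: (m i) => [|j IHj]; rewrite ?expr0 // exprS; apply: (PM).
Qed.

Lemma max_slope (L : seq (nat * nat)) : L != [::] ->
    {in L, forall x, (0 < x.1)%N} ->
  exists2 x, x \in L & {in L, forall y, (y.2 * x.1 <= x.2 * y.1)%N}.
Proof.
elim: L => // y L IHL _ L0.
have y0 : (0 < y.1)%N by apply: L0; rewrite mem_head.
case: (eqVneq L [::]) => [->|nL].
  by exists y; [rewrite mem_head | move=> z /[1!inE]/eqP->].
have [|x xL xM] := IHL nL.
  by move=> z zL; apply: L0; rewrite in_cons zL orbT.
have x0 : (0 < x.1)%N by apply: L0; rewrite in_cons xL orbT.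
have [le_yx|lt_xy] := leqP (y.2 * x.1) (x.2 * y.1).
  exists x; first by rewrite in_cons xL orbT.
  by move=> z /[1!inE] /orP[/eqP ->|/xM].
exists y; first by rewrite mem_head.
move=> z /[1!inE] /orP[/eqP ->|/xM le_zx] //.
rewrite -(leq_pmul2l x0).
have := leq_mul le_zx (leqnn y.1); have := leq_mul (ltnW lt_xy) (leqnn z.1).
by move: x.1 x.2 y.1 y.2 z.1 z.2 => *; lia.
Qed.

Lemma size_comp_Xn (R : nzRingType) (p : {poly R}) nu w :
  (nu * (size p).-1 <= w)%N -> (size (p \Po 'X^nu) <= w.+1)%N.
Proof.
move=> le_w; apply: leq_trans (size_comp_poly_leq _ _) _.
by rewrite size_polyXn ltnS mulnC.
Qed.

Lemma lead_coef_comp_Xn (R : nzRingType) (p : {poly R}) nu : (0 < nu)%N ->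
  (p \Po 'X^nu)`_(nu * (size p).-1) = lead_coef p.
Proof. by move=> nu0; rewrite coef_comp_poly_Xn // dvdn_mulr // mulKn. Qed.

Section Rigidity.
Variables (k : fieldType) (n : nat) (A : idomainType).
Variable pi : {rmorphism {mpoly k[n]} -> A}.
Hypothesis pi_surj : forall a, exists p, a = pi p.
Variable tau : {rmorphism {poly A} -> {poly {poly A}}}.
Hypotheses (tau0 : at_zero tau) (tauD : exp_law tau).

Lemma tau_scalar (c : k) : (pi c%:MP)%:P \in consts tau.
Proof.
have [->|c0] := eqVneq c 0; first by rewrite mpolyC0 rmorph0 rpred0.
apply: (unit_consts tau0); rewrite unit_polyC rmorph_unit //.
by rewrite rmorph_unit // unitfE.
Qed.

Lemma weight_le_const nu rho p : p \in consts tau -> (size p <= 1)%N ->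
  weight_le tau nu rho p 0.
Proof.
move=> /constsP tp le_p i; apply: size_comp_Xn; rewrite tp coefC.
case: (i == _); last by rewrite size_poly0 muln0.
by case: (size p) le_p => [|[|]]; rewrite ?muln0.
Qed.

Lemma weight_le_gens nu rho :
    (forall i, weight_le tau nu rho (pi 'X_i)%:P 0) ->
  forall a, weight_le tau nu rho a%:P 0.
Proof.
move=> wX a; have [p ->] := pi_surj a.
apply: (mpoly_image_ind (P := fun a => weight_le tau nu rho a%:P 0)) => //.
- by move=> x y wx wy; rewrite polyCD; apply: weight_leD.
- by move=> x y wx wy; rewrite polyCM; exact: (weight_leM wx wy).
- by move=> c; apply: weight_le_const (tau_scalar c) (size_polyC_leq1 _).
Qed.

Lemma nontrivial_gen : (exists a, a%:P \notin consts tau) ->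
  exists i j, (0 < j)%N /\ (tau (pi 'X_i)%:P)`_j != 0.
Proof.
case=> a; have [p ->] := pi_surj a => /negP H.
apply: NNPP => N; apply: H.
apply: (mpoly_image_ind (P := fun a => a%:P \in consts tau)) => //.
- by move=> x y; rewrite polyCD; apply: rpredD.
- by move=> x y; rewrite polyCM; apply: rpredM.
- exact: tau_scalar.
move=> i; apply/constsP/polyP => -[|j]; first by rewrite coefC tau0.
rewrite coefC /=; apply: NNPP => /eqP nz; apply: N.
by exists i, j.+1.
Qed.

(** The slope [rho / nu] is the largest ratio of the degree in [t] (minus one
    for [t] itself) to the degree in [U] among the terms of [tau] on generators.
    Some leading form is then non-trivial, and it is not that of [t] by
    [lead_formX]. *)
Theorem descend_exp_map : (exists a, a%:P \notin consts tau) ->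
  exists delta : {rmorphism A -> {poly A}},
    [/\ at_zero delta, exp_law delta & exists a, a \notin consts delta].
Proof.
case/nontrivial_gen => i1 [j1 [j1_gt0 nz1]].
pose g i := (pi 'X_i)%:P : {poly A}.
pose L := [seq (j, (size ((tau (g i))`_j)%R).-1) |
             i <- enum 'I_n, j <- iota 1 (size (tau (g i)))]
       ++ [seq (j, (size ((tau 'X)`_j)%R).-2) | j <- iota 1 (size (tau 'X))].
have gL i j : (0 < j)%N -> (tau (g i))`_j != 0 ->
    (j, (size (tau (g i))`_j).-1) \in L.
  move=> j0 nz; rewrite mem_cat; apply/orP; left; apply/allpairsPdep.
  exists i, j; split=> //; first by rewrite mem_enum.
  rewrite mem_iota j0 /= add1n ltnW // ltnS ltnNge; apply: contra nz => le_j.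
  by rewrite nth_default.
have XL j : (0 < j)%N -> (tau 'X)`_j != 0 -> (j, (size (tau 'X)`_j).-2) \in L.
  move=> j0 nz; rewrite mem_cat; apply/orP; right; apply/mapP; exists j => //.
  rewrite mem_iota j0 /= add1n ltnW // ltnS ltnNge; apply: contra nz => le_j.
  by rewrite nth_default.
have L1 := gL i1 j1 j1_gt0 nz1.
have [||[i0 j0] /= ijL maxL] := @max_slope L.
- by case: (L) L1.
- move=> x; rewrite mem_cat => /orP[/allpairsPdep[i [j [_ jI ->]]]|/mapP[j jI ->]] /=.
    by move: jI; rewrite mem_iota => /andP[].
  by move: jI; rewrite mem_iota => /andP[].
have i0_gt0 : (0 < i0)%N.
  move: ijL; rewrite mem_cat => /orP[/allpairsPdep[i [j [_ jI [-> _]]]]|/mapP[j jI [-> _]]] /=.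
    by move: jI; rewrite mem_iota => /andP[].
  by move: jI; rewrite mem_iota => /andP[].
(* The degree of [t] itself is corrected by one, whence the term [nu]. *)
have [nu [rho [nu0 maxg maxX nontriv]]] : exists nu rho, [/\ (0 < nu)%N,
    forall i j, (0 < j)%N -> (tau (g i))`_j != 0 ->
      (nu * (size ((tau (g i))`_j)%R).-1 <= rho * j)%N,
    forall j, (0 < j)%N -> (tau 'X)`_j != 0 ->
      (nu * (size ((tau 'X)`_j)%R).-1 <= nu + rho * j)%N
    & (exists i j, [/\ (0 < j)%N, (tau (g i))`_j != 0 &
        (nu * (size ((tau (g i))`_j)%R).-1 = rho * j)%N]) \/
      (exists j, [/\ (0 < j)%N, (tau 'X)`_j != 0 &
        (nu * (size ((tau 'X)`_j)%R).-1 = nu + rho * j)%N])].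
  (* In slope zero the truncated degree of the terms of [tau 'X] may hide a
     degree zero, so the non-trivial term is taken from a generator of [A]. *)
  have [j00|j0_gt0] := posnP j0.
    have flat x : x \in L -> x.2 = 0%N.
      by move/maxL; rewrite j00 mul0n leqn0 muln_eq0 (gtn_eqF i0_gt0) orbF => /eqP.
    exists 1%N, 0%N; split=> // [i j j_gt0 nz|j j_gt0 nz|].
    - by have /= -> := flat _ (gL i j j_gt0 nz).
    - have /= := flat _ (XL j j_gt0 nz); rewrite mul1n mul0n addn0.
      by case: (size _) => [|[|]] //= m ->.
    - left; exists i1, j1; split=> //.
      by have /= -> := flat _ (gL i1 j1 j1_gt0 nz1).
  exists i0, j0; split=> // [i j j_gt0 nz|j j_gt0 nz|].
  - by rewrite mulnC; apply: (maxL _ (gL i j j_gt0 nz)).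
  - have /= := maxL _ (XL j j_gt0 nz).
    by case: (size _) => [|[|m]] /=; rewrite ?muln0 ?muln1 ?leq_addr // mulnS leq_add2l mulnC.
  - move: ijL; rewrite mem_cat => /orP[/allpairsPdep[i [j [_ _ [iE jE]]]]|/mapP[j _ [iE jE]]].
    + subst i0; left; exists i, j; split=> //; last by rewrite -jE mulnC.
      by apply: contraTneq j0_gt0 => z; rewrite jE z size_poly0.
    + subst i0; right; exists j; split=> //.
        by apply: contraTneq j0_gt0 => z; rewrite jE z size_poly0.
      move: j0_gt0; rewrite jE.
      by case: (size _) => [|[|m]] //= _; rewrite mulnS mulnC.
have wA : forall a, weight_le tau nu rho a%:P 0.
  apply: weight_le_gens => i [|j]; apply: size_comp_Xn.
    by rewrite tau0 size_polyC; case: (_ != 0); rewrite /= muln0.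
  have [->|nz] := eqVneq (tau (pi 'X_i)%:P)`_j.+1 0; first by rewrite size_poly0 muln0.
  exact: maxg.
have wX : weight_le tau nu rho 'X nu.
  move=> [|j]; apply: size_comp_Xn.
    by rewrite tau0 size_polyX muln1 leq_addr.
  have [->|nz] := eqVneq (tau 'X)`_j.+1 0; first by rewrite size_poly0 muln0.
  exact: maxX.
pose delta := lead_exp_morphism wA.
exists delta; split.
- exact: lead_exp_at_zero.
- exact: lead_exp_law.
case: nontriv => [[i [j [j0' nz E]]]|[j [j0' nz E]]]; last first.
  have /(congr1 (fun p : {poly A} => p`_j)) := lead_formX tau0 tauD nu0 wA wX.
  rewrite coef_lead_form -E lead_coef_comp_Xn // coef1 (gtn_eqF j0') => /eqP.
  by rewrite lead_coef_eq0 (negPf nz).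
exists (pi 'X_i); apply/negP => /constsP/(congr1 (fun p : {poly A} => p`_j)).
rewrite coef_lead_form add0n -E lead_coef_comp_Xn // coefC (gtn_eqF j0') => /eqP.
by rewrite lead_coef_eq0 (negPf nz).
Qed.

End Rigidity.

(** * Exponential maps of polynomial rings *)

Lemma coef_comp_XD (R : comNzRingType) (p : {poly R}) i j :
  (p^:P \Po ('X + 'X%:P))`_j`_i = p`_(i + j) *+ 'C(i + j, i).
Proof.
have -> : p^:P \Po ('X + 'X%:P) =
    \poly_(l < size p) p^`N(l).
  rewrite /comp_poly addrC nderiv_taylor; last exact: mulrC.
  rewrite !size_map_polyC poly_def; apply: eq_bigr => l _.
  rewrite -mul_polyC; congr (_ * _).
  rewrite !nderivn_map horner_map /=; congr (_%:P).
  exact: comp_polyXr.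
rewrite coef_poly; case: ltnP => [lt_j|le_j]; last first.
  by rewrite coef0 nth_default ?mul0rn // (leq_trans le_j) // leq_addl.
rewrite coef_nderivn [(j + i)%N]addnC; congr (_ *+ _).
by rewrite -(bin_sub (leq_addl i j)) addnK.
Qed.

Lemma exp_law_of_comp (R : idomainType) (sigma : {rmorphism R -> {poly R}}) :
  (forall x, map_poly sigma (sigma x) = (sigma x)^:P \Po ('X + 'X%:P)) ->
  exp_law sigma.
Proof. by move=> H x i j; rewrite -coef_comp_XD -H coef_map. Qed.

Section Shift.
Variables (k : fieldType) (n : nat).

Definition shift_image (i j : 'I_n) : {poly {mpoly k[n]}} :=
  ('X_j)%:P + (if i == j then 'X else 0).

Definition shift (i : 'I_n) : {rmorphism {mpoly k[n]} -> {poly {mpoly k[n]}}} :=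
  mmap (polyC \o @mpolyC n k) (shift_image i).

Lemma shiftC i c : shift i c%:MP = (c%:MP)%:P.
Proof. exact: mmapC. Qed.

Lemma shiftX i j : shift i 'X_j = ('X_j)%:P + (if i == j then 'X else 0).
Proof. by rewrite /shift /= mmapX mmap1U. Qed.

Lemma shift_at_zero i : at_zero (shift i).
Proof.
move=> x; rewrite -horner_coef0.
apply: (mpoly_hom_ext (f := horner_eval 0 \o shift i) (g := idfun)) => /= [c|j].
  by rewrite /horner_eval shiftC hornerC.
rewrite /horner_eval shiftX hornerD hornerC.
by case: ifP; rewrite ?hornerX ?horner0 addr0.
Qed.

Lemma shift_exp_law i : exp_law (shift i).
Proof.
apply: exp_law_of_comp.
apply: (mpoly_hom_ext (f := map_poly (shift i) \o shift i)
  (g := comp_poly ('X + 'X%:P) \o map_poly polyC \o shift i)) => /= [c|j].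
  by rewrite shiftC !map_polyC /= shiftC comp_polyC.
rewrite shiftX !rmorphD /= !map_polyC /= comp_polyC shiftX.
case: ifP => _; last by rewrite !rmorph0 !addr0.
by rewrite !map_polyX comp_polyX rmorphD /= -addrA ['X%:P + _]addrC.
Qed.

(** Substituting [- X_i] for the parameter of the shift along [X_i] sets [X_i]
    to zero. *)
Lemma shift_constants (f : {mpoly k[n]}) :
  (forall i, f \in consts (shift i)) -> exists c, f = c%:MP.
Proof.
move=> fC.
pose kill (s : seq 'I_n) : {mpoly k[n]} -> {mpoly k[n]} :=
  mmap (@mpolyC n k) (fun j => if j \in s then 0 else 'X_j).
have killf s : f = kill s f.
  elim: s => [|i s IHs].
    apply: esym; apply: (mpoly_hom_ext (f := kill [::]) (g := idfun)) => /= [c|j].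
      exact: mmapC.
    by rewrite /kill mmapX mmap1U.
  have E : f = kill [:: i] f.
    have -> : kill [:: i] f = (shift i f).[- 'X_i].
      apply: (mpoly_hom_ext (f := kill [:: i]) (g := horner_eval (- 'X_i) \o shift i)) => /= [c|j].
        by rewrite /horner_eval shiftC hornerC; apply: mmapC.
      rewrite /horner_eval shiftX /kill mmapX mmap1U inE hornerD hornerC eq_sym.
      by case: eqP => [->|_]; rewrite ?hornerX ?horner0 ?addr0 ?subrr.
    by rewrite (constsP _ _ (fC i)) hornerC.
  rewrite {1}E {1}IHs.
  apply: (mpoly_hom_ext (f := kill [:: i] \o kill s) (g := kill (i :: s))) => /= [c|j].
    by rewrite /kill !mmapC.
  rewrite /kill [X in mmap _ _ X]mmapX [X in mmap _ _ X]mmap1U [RHS]mmapX [RHS]mmap1U in_cons.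
  case: (j \in s); first by rewrite orbT rmorph0.
  by rewrite orbF mmapX mmap1U inE.
exists (meval (fun=> 0) f); rewrite {1}(killf (enum 'I_n)).
apply: (mpoly_hom_ext (f := kill (enum 'I_n)) (g := @mpolyC n k \o meval (fun=> 0))) => /= [c|j].
  by rewrite /kill mmapC mevalC.
by rewrite /kill mmapX mmap1U mem_enum mevalXU mpolyC0.
Qed.

End Shift.

Section InverseMorphism.
Variables (R S : nzRingType) (f : {rmorphism R -> S}) (g : S -> R).
Hypotheses (fK : cancel f g) (gK : cancel g f).

Definition inverse_fun (y : S) : R := g y.

Fact inverse_zmod_morphism : zmod_morphism inverse_fun.
Proof. by move=> x y; apply: (can_inj fK); rewrite rmorphB /inverse_fun !gK. Qed.

Fact inverse_monoid_morphism : monoid_morphism inverse_fun.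
Proof.
split=> [|x y]; apply: (can_inj fK); first by rewrite rmorph1 /inverse_fun gK.
by rewrite rmorphM /inverse_fun !gK.
Qed.

HB.instance Definition _ := GRing.isZmodMorphism.Build S R inverse_fun
  inverse_zmod_morphism.
HB.instance Definition _ := GRing.isMonoidMorphism.Build S R inverse_fun
  inverse_monoid_morphism.

Definition inverse_morphism : {rmorphism S -> R} := inverse_fun.

End InverseMorphism.

Lemma bijective_inverse (R S : nzRingType) (f : {rmorphism R -> S}) :
  injective f -> (forall y, exists x, y = f x) ->
  exists g : {rmorphism S -> R}, cancel f g /\ cancel g f.
Proof.
move=> f_inj f_surj.
have H y : exists x, f x == y by have [x ->] := f_surj y; exists x.
pose g y := xchoose (H y).
have gK : cancel g f by move=> y; apply/eqP/(xchooseP (H y)).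
have fK : cancel f g by move=> x; apply: f_inj; rewrite gK.
by exists (inverse_morphism fK gK).
Qed.

(** Only the structure of a factorial domain and the isomorphism [Theta] matter
    from here on, so the ring of constants is given by an abstract domain [A]. *)
Corollary retract_presentation (B : idomainType)
    (sigma : {rmorphism B -> {poly B}}) (phi : {rmorphism B -> B}) :
    ufd B -> at_zero sigma -> exp_law sigma ->
    (forall x, phi x \in consts sigma) ->
    (forall x, x \in consts sigma -> phi x = x) ->
    (exists x, x \notin consts sigma) ->
  exists (A : idomainType) (Theta : {rmorphism {poly A} -> B})
      (Xi : {rmorphism B -> {poly A}}),
    [/\ cancel Theta Xi, cancel Xi Theta, ufd A
      & forall b, b \in consts sigma <-> exists a, b = Theta a%:P].
Proof.
move=> facB sigma0 sigmaD phi_in phi_id nontriv.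
have [t [t_gen t_indep]] :=
  retract_polynomial_ring facB sigma0 sigmaD phi_in phi_id nontriv.
have Theta_inj : injective (peval (const_val sigma) t) by apply: raddf_inj.
have [Xi [ThetaK XiK]] := bijective_inverse Theta_inj t_gen.
exists (const_ring sigma), (peval (const_val sigma) t), Xi; split=> //.
  exact: ufd_const_ring.
move=> b; split=> [/consts_lift[a ->]|[a ->]]; first by exists a; rewrite /= pevalC.
by rewrite /= pevalC; apply: (valP a).
Qed.

Section Transport.
Variables (R S : idomainType) (f : {rmorphism R -> S}) (g : {rmorphism S -> R}).
Hypotheses (fK : cancel f g) (gK : cancel g f).
Variable tau : {rmorphism S -> {poly S}}.

Definition transport : {rmorphism R -> {poly R}} := map_poly g \o tau \o f.

Lemma coef_transport x i : (transport x)`_i = g (tau (f x))`_i.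
Proof. by rewrite /transport /= coef_map. Qed.

Lemma transport_at_zero : at_zero tau -> at_zero transport.
Proof. by move=> tau0 x; rewrite coef_transport tau0 fK. Qed.

Lemma transport_exp_law : exp_law tau -> exp_law transport.
Proof. by move=> tauD x i j; rewrite !coef_transport gK tauD rmorphMn. Qed.

Lemma transport_consts x : (x \in consts transport) = (f x \in consts tau).
Proof.
apply/constsP/constsP => [xC|fxC].
  apply/polyP => i; have := congr1 (fun p : {poly R} => f p`_i) xC.
  by rewrite coef_transport gK => ->; rewrite !coefC; case: ifP; rewrite ?rmorph0.
by apply/polyP => i; rewrite coef_transport fxC !coefC; case: ifP; rewrite ?fK ?rmorph0.
Qed.

End Transport.

(** * Adjoining a root *)

Lemma adjoin_root (k : fieldType) (h : {poly k}) : prime_elt h ->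
  exists (L : fieldType) (red : {rmorphism {poly k} -> L}),
    (forall x, exists P, x = red P) /\ (forall P, red P = 0 <-> divides h P).
Proof.
case=> h0 hU hM.
have lh0 : lead_coef h != 0 by rewrite lead_coef_eq0.
pose g := (lead_coef h)^-1 *: h.
have gm : g \is monic by rewrite monicE lead_coefZ mulVf.
have szg : size g = size h by rewrite size_scale ?invr_eq0.
have hE : h = lead_coef h *: g by rewrite scalerA divff ?scale1r.
have dvd_gh P : divides g P <-> divides h P.
  split=> [[z ->]|[z ->]].
    by exists ((lead_coef h)^-1 *: z); rewrite -scalerAl -scalerAr.
  by exists (lead_coef h *: z); rewrite {1}hE -scalerAl -scalerAr.
have sz1 : (1 < size g)%N.
  rewrite szg ltnNge; apply: contra hU => /size1_polyC E.
  by rewrite E unit_polyC unitfE; apply: contra_neq h0 => h00; rewrite E h00.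
have gI : irreducible_poly g.
  split=> // q szq /dvdpP[r gE].
  have g0 : g != 0 by rewrite -size_poly_gt0 ltnW.
  have [|[z zE]|[z zE]] := hM r q.
  - by apply/dvd_gh; rewrite -gE; apply: dvd_refl.
  - case/negP: szq.
    have E : (z * (lead_coef h)%:P) * q = 1.
      by apply: (mulIf g0); rewrite mul1r [RHS]gE zE {2}hE -mul_polyC; ring.
    have : q \is a GRing.unit.
      by apply/unitrP; exists (z * (lead_coef h)%:P); split; rewrite // mulrC.
    by rewrite poly_unitE => /andP[].
  - rewrite /eqp gE dvdp_mull //= -gE zE hE -scalerAr dvdpZr //.
    by rewrite dvdp_mull.
pose gmi : monic_irreducible_poly g := (gI, gm).
exists {poly %/ g with gmi}, (in_qpoly g); split=> [x|P].
  by exists (x : {poly k}); apply/val_inj/esym/in_qpoly_small/size_mk_monic.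
rewrite -dvd_gh.
have modE : in_qpoly g P = P %% g :> {poly k}.
  by rewrite /= (mk_monicE gmi) Pdiv.IdomainMonic.modpE.
split=> [P0|[z zE]].
  by exists (P %/ g); rewrite {1}(Pdiv.Field.divp_eq P g) -modE P0 addr0.
apply: (etrans (y := in_qpoly g 0)); last exact: in_qpoly0.
by apply/val_inj; move: modE; rewrite zE modp_mull /= => ->; rewrite Pdiv.Ring.rmod0p.
Qed.

(** * Base change along a simple extension *)

(** [S] is presented as [R[X] / (h)], with [X] mapped to [mu]. *)
Record base_change (R S : idomainType) (j : {rmorphism R -> S}) (mu : S)
    (h : {poly R}) : Prop := BaseChange {
  bc_lead : lead_coef h \is a GRing.unit;
  bc_root : peval j mu h = 0;
  bc_surj : forall b, exists Q, b = peval j mu Q;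
  bc_ker : forall Q, peval j mu Q = 0 -> divides h Q
}.

Lemma map_polyC_lead (R S : idomainType) (f : {rmorphism R -> S}) (p : {poly R}) :
  lead_coef p \is a GRing.unit -> injective f ->
  lead_coef (map_poly f p) \is a GRing.unit.
Proof. by move=> lU f_inj; rewrite lead_coef_map_inj ?rmorph0 // rmorph_unit. Qed.

Section Reduced.
Variables (R S : idomainType) (j : {rmorphism R -> S}) (mu : S) (h : {poly R}).
Hypothesis bc : base_change j mu h.
Local Notation red := (peval j mu).

Lemma bc_neq0 : h != 0.
Proof.
rewrite -lead_coef_eq0; apply: contraTneq (bc_lead bc) => ->.
by rewrite unitr0.
Qed.

Lemma bc_reduced b : exists2 Q : {poly R}, (size Q < size h)%N & b = red Q.
Proof.
have [Q ->] := bc_surj bc b; exists (Q %% h).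
  by rewrite Pdiv.Idomain.ltn_modp bc_neq0.
rewrite {1}(Pdiv.IdomainUnit.divp_eq (bc_lead bc) Q) rmorphD rmorphM /=.
by rewrite (bc_root bc) mulr0 add0r.
Qed.

Lemma bc_small (Q : {poly R}) : (size Q < size h)%N -> red Q = 0 -> Q = 0.
Proof.
move=> lt_Q /(bc_ker bc)[z zE]; apply/eqP; apply: contraTT lt_Q => Q0.
have z0 : z != 0 by apply: contra_neq Q0 => z0; rewrite zE z0 mul0r.
rewrite zE size_mul ?bc_neq0 // -leqNgt -[size z]prednK ?size_poly_gt0 //.
exact: leq_addl.
Qed.

Lemma bc_dvd c (Q : {poly R}) : (size Q < size h)%N ->
  divides (red c%:P) (red Q) -> divides c%:P Q.
Proof.
move=> lt_Q [z]; have [Z lt_Z ->] := bc_reduced z; rewrite -rmorphM => E.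
exists Z; apply/eqP; rewrite -subr_eq0; apply/eqP/bc_small; last first.
  by rewrite rmorphB /= E subrr.
apply: leq_ltn_trans (size_polyD _ _) _; rewrite gtn_max lt_Q size_polyN mulrC.
by rewrite mul_polyC (leq_ltn_trans (size_scale_leq _ _)).
Qed.

Variables (delta : {rmorphism R -> {poly R}}) (deltaS : {rmorphism S -> {poly S}}).
Hypothesis deltaS_j : forall b, deltaS (j b) = map_poly j (delta b).
Hypothesis deltaS_mu : deltaS mu = mu%:P.

Lemma bc_delta Q :
  deltaS (red Q) = map_poly red (swapXY (map_poly delta Q)).
Proof.
apply: (poly_hom_ext (f := deltaS \o red)
   (g := map_poly red \o @swapXY R \o map_poly delta)) => /= [b|].
  rewrite pevalC deltaS_j map_polyC /= swapXY_polyC -map_poly_comp.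
  by apply: eq_map_poly => a /=; rewrite pevalC.
by rewrite pevalX map_polyX swapXY_X map_polyC /= pevalX.
Qed.

Lemma bc_at_zero : at_zero delta -> at_zero deltaS.
Proof.
move=> delta0 b; have [Q ->] := bc_surj bc b.
rewrite bc_delta coef_map; congr red; apply/polyP => l.
by rewrite coef_swapXY coef_map delta0.
Qed.

(** By uniqueness of reduced representatives, a constant of the extension has
    constant coordinates. *)
Lemma bc_consts b : at_zero delta -> b \in consts deltaS ->
  exists2 Q : {poly R}, b = red Q & forall l, Q`_l \in consts delta.
Proof.
move=> delta0; have [Q lt_Q ->] := bc_reduced b => /constsP QC.
exists Q => // l; apply/constsP/polyP => -[|i]; first by rewrite coefC delta0.
have := congr1 (fun p : {poly S} => p`_i.+1) QC.
rewrite bc_delta coef_map !coefC /= => /bc_small E.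
rewrite -coef_map -[map_poly delta Q]swapXYK coef_swapXY E ?coef0 //.
apply: leq_ltn_trans lt_Q; apply/leq_sizeP => m le_m.
by rewrite coef_swapXY coef_map /= [Q`_m]nth_default // rmorph0 coef0.
Qed.

End Reduced.

(** The coordinates of an element of the kernel of [evS] are in the kernel of
    [ev]. *)
Lemma bc_injective (R S T TS : idomainType) (j : {rmorphism R -> S}) mu h
    (jT : {rmorphism T -> TS}) muT hT (ev : {rmorphism T -> R})
    (evS : {rmorphism TS -> S}) :
    base_change j mu h -> base_change jT muT hT -> size h = size hT ->
    (forall b, evS (jT b) = j (ev b)) -> evS muT = mu ->
  (forall x, ev x = 0 -> x = 0) -> forall y, evS y = 0 -> y = 0.
Proof.
move=> bc bcT szE evS_j evS_mu ev_inj y.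
have [Q lt_Q ->] := bc_reduced bcT y => E.
have mapQ : map_poly ev Q = 0.
  apply: (bc_small bc).
    by rewrite szE; apply: leq_ltn_trans lt_Q; apply: size_poly.
  rewrite -[RHS]E [RHS]peval_comp evS_mu.
  apply: (poly_hom_ext (f := peval j mu \o map_poly ev) (g := peval (evS \o jT) mu)) => /= [c|].
    by rewrite map_polyC !pevalC /= evS_j.
  by rewrite map_polyX !pevalX.
have -> : Q = 0; last by rewrite rmorph0.
apply/polyP => i; rewrite coef0; apply: ev_inj.
by rewrite -coef_map mapQ coef0.
Qed.

Lemma divides_polyC (R : idomainType) (c : R) (p : {poly R}) :
  (forall i, divides c p`_i) -> divides c%:P p.
Proof.
elim/poly_ind: p => [|p a IHp] H; first by exists 0; rewrite mul0r.
have [z zE] := H 0%N; rewrite coefD coefMX coefC eqxx add0r in zE.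
have [|q ->] := IHp; last by exists (q * 'X + z%:P); rewrite zE polyCM; ring.
by move=> i; have := H i.+1; rewrite coefD coefMX coefC /= addr0.
Qed.

(** After exchanging the two variables the statement is about coefficients. *)
Lemma bc_poly (R S : idomainType) (j : {rmorphism R -> S}) mu h :
  base_change j mu h ->
  base_change (map_poly j : {rmorphism {poly R} -> {poly S}}) mu%:P (map_poly polyC h).
Proof.
move=> bc.
have swapE Q : peval (map_poly j) mu%:P Q = map_poly (peval j mu) (swapXY Q).
  apply: (poly_hom_ext (f := peval (map_poly j) mu%:P)
    (g := map_poly (peval j mu) \o @swapXY R)) => /= [b|].
    rewrite pevalC /= swapXY_polyC -map_poly_comp.
    by apply: eq_map_poly => a /=; rewrite pevalC.
  by rewrite pevalX swapXY_X map_polyC /= pevalX.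
split.
- by apply: map_polyC_lead (bc_lead bc) _; apply: polyC_inj.
- by rewrite swapE swapXY_map_polyC map_polyC /= (bc_root bc).
- elim/poly_ind => [|p c [Q QE]]; first by exists 0; rewrite rmorph0.
  have [Qc cE] := bc_surj bc c.
  exists (Q * 'X%:P + map_poly polyC Qc); rewrite rmorphD rmorphM /= -QE pevalC /= map_polyX.
  by rewrite swapE swapXY_map_polyC map_polyC /= -cE.
move=> Q; rewrite swapE => E.
have [|Z ZE] := @divides_polyC _ h (swapXY Q).
  by move=> i; apply: (bc_ker bc); rewrite -coef_map E coef0.
exists (swapXY Z); rewrite -[Q]swapXYK ZE rmorphM /= swapXY_polyC; by [].
Qed.

(** Coefficientwise, the kernel consists of multiples of [h]; the remainder of
    the division by [h] has coefficients of smaller degree, so it vanishes. *)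
Lemma bc_mpoly (k L : fieldType) (j : {rmorphism k -> L}) mu h n :
  base_change j mu h ->
  base_change (map_mpoly j : {rmorphism {mpoly k[n]} -> {mpoly L[n]}}) mu%:MP
    (map_poly (@mpolyC n k) h).
Proof.
move=> bc.
have mcoeffE Q m : (peval (map_mpoly j) mu%:MP_[n] Q)@_m =
    peval j mu (map_poly (mcoeff m) Q).
  rewrite pevalE raddf_sum (@peval_wide _ _ _ _ (size Q)); last exact: size_poly.
  apply: eq_bigr => i _; rewrite coef_map /=.
  by rewrite -rmorphXn /= mulrC mul_mpolyC mcoeffZ mcoeff_map_mpoly mulrC.
have constE P : peval (map_mpoly j) mu%:MP_[n] (map_poly (@mpolyC n k) P) = (peval j mu P)%:MP.
  apply: (poly_hom_ext (f := peval (map_mpoly j) mu%:MP_[n] \o map_poly (@mpolyC n k))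
    (g := @mpolyC n L \o peval j mu)) => /= [c|].
    by rewrite map_polyC !pevalC /= map_mpolyC.
  by rewrite map_polyX !pevalX.
have lU : lead_coef (map_poly (@mpolyC n k) h) \is a GRing.unit.
  by apply: map_polyC_lead (bc_lead bc) _; apply: mpolyC_injective.
have szh : size (map_poly (@mpolyC n k) h) = size h.
  by apply: size_map_inj_poly; [apply: mpolyC_injective | apply: mpolyC0].
split=> // [||Q E].
- by rewrite constE (bc_root bc) mpolyC0.
- move=> b; rewrite [b]mpolyE.
  pose P (x : {mpoly L[n]}) := exists Q, x = peval (map_mpoly j) mu%:MP_[n] Q.
  apply: (big_ind P) => [|x y [Q1 ->] [Q2 ->]|m _].
  + by exists 0; rewrite rmorph0.
  + by exists (Q1 + Q2); rewrite rmorphD.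
  have [Q QE] := bc_surj bc b@_m.
  exists (map_poly (@mpolyC n k) Q * ('X_[m])%:P).
  by rewrite rmorphM /= constE -QE pevalC /= map_mpolyX mul_mpolyC.
have {}lU := Pdiv.IdomainUnit.divp_eq lU Q.
set r := (Q %% _)%R in lU.
suff r0 : r = 0 by exists (Q %/ map_poly (@mpolyC n k) h)%R; rewrite {1}lU r0 addr0.
have lt_r : (size r < size h)%N.
  by rewrite -szh Pdiv.Idomain.ltn_modp -size_poly_gt0 szh size_poly_gt0 (bc_neq0 bc).
apply/polyP => i; rewrite coef0; apply/mpolyP => m; rewrite mcoeff0.
have := coef_map (mcoeff m) r i => /= <-.
rewrite (_ : map_poly (mcoeff m) r = 0) ?coef0 //; apply: (bc_small bc).
  by apply: leq_ltn_trans lt_r; apply: size_poly.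
rewrite -mcoeffE; move: E; rewrite lU rmorphD rmorphM /= constE (bc_root bc) mpolyC0 mulr0 add0r.
by move=> ->; rewrite mcoeff0.
Qed.

(** * Fibres of a generator of the constants *)

Definition pev (k R : comNzRingType) (iota : {rmorphism k -> R}) (f t : R) :
  {rmorphism {poly {poly k}} -> R} := peval (peval iota f) t.

Lemma scalar_consts (k : fieldType) n
    (delta : {rmorphism {mpoly k[n]} -> {poly {mpoly k[n]}}}) c :
  at_zero delta -> delta c%:MP = (c%:MP)%:P.
Proof.
move=> delta0; apply/constsP; have [->|c0] := eqVneq c 0.
  by rewrite mpolyC0 rpred0.
by apply: (unit_consts delta0); rewrite rmorph_unit // unitfE.
Qed.

(** The ring of constants is the polynomial ring [k[f, t]]. *)
Record plane_constants (k : fieldType) n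
    (delta : {rmorphism {mpoly k[n]} -> {poly {mpoly k[n]}}})
    (f t : {mpoly k[n]}) : Prop := PlaneConstants {
  pc_at_zero : at_zero delta;
  pc_f : f \in consts delta;
  pc_t : t \in consts delta;
  pc_gen : forall b, b \in consts delta -> exists W, b = pev (@mpolyC n k) f t W;
  pc_indep : forall W, pev (@mpolyC n k) f t W = 0 -> W = 0
}.

(** A factorization of [f - lambda] takes place in [k[f, t]], where this
    element has degree one in [f]; and irreducible elements are prime. *)
Lemma fibre_prime (k : fieldType) n
    (delta : {rmorphism {mpoly k[n]} -> {poly {mpoly k[n]}}}) f t (lambda : k) :
  plane_constants delta f t -> prime_elt (f - lambda%:MP).
Proof.
case=> delta0 fC tC gen indep; set ev := pev _ _ _ in gen indep.
have evE : f - lambda%:MP = ev ('X - lambda%:P)%:P.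
  by rewrite /ev /pev /= pevalC /= rmorphB /= pevalX pevalC.
have evC c : ev (c%:P)%:P = c%:MP by rewrite /ev /pev /= !pevalC /= pevalC.
have fl0 : f - lambda%:MP != 0.
  apply/eqP; rewrite evE => /indep/eqP; rewrite polyC_eq0 -size_poly_eq0.
  by rewrite size_XsubC.
apply: ufd_irreducible => //; first exact: ufd_mpoly.
  apply/negP => /mpoly_unit_scalar E.
  have /indep/eqP : ev ('X - (lambda + (f - lambda%:MP)@_0)%:P)%:P = 0.
    by rewrite [X in 'X - X]polyCD opprD addrA polyCB rmorphB -evE evC -E subrr.
  by rewrite polyC_eq0 polyXsubC_eq0.
move=> y z E.
have yzC : f - lambda%:MP \in consts delta.
  by rewrite rpredB //; apply/constsP/scalar_consts.
have y0 : y != 0 by apply: contra_neq fl0; rewrite E => ->; rewrite mul0r.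
have z0 : z != 0 by apply: contra_neq fl0; rewrite E => ->; rewrite mulr0.
have [|Wy yE] := gen y; first by apply: (consts_factor delta0 y0 z0); rewrite -E.
have [|Wz zE] := gen z.
  by apply: (consts_factor delta0 z0 y0); rewrite mulrC -E.
have WE : Wy * Wz = ('X - lambda%:P)%:P.
  apply/eqP; rewrite -subr_eq0; apply/eqP/indep.
  by rewrite rmorphB rmorphM -yE -zE -E -evE subrr.
have small (W1 W2 : {poly {poly k}}) : W1 * W2 = ('X - lambda%:P)%:P ->
    exists w, W1 = w%:P.
  move=> W12; exists W1`_0; apply: size1_polyC.
  have := congr1 (fun p : {poly {poly k}} => size p) W12.
  rewrite size_polyC polyXsubC_eq0 /=.
  have W10 : W1 != 0.
    by apply/eqP => W10; move/eqP: W12; rewrite W10 mul0r eq_sym polyC_eq0 polyXsubC_eq0.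
  have W20 : W2 != 0.
    by apply/eqP => W20; move/eqP: W12; rewrite W20 mulr0 eq_sym polyC_eq0 polyXsubC_eq0.
  have aux (a b : nat) : (0 < a)%N -> (0 < b)%N -> (a + b).-1 = 1%N -> (a <= 1)%N.
    by clear; lia.
  by rewrite size_mul //; apply: aux; rewrite size_poly_gt0.
have [wy WyE] := small _ _ WE.
have [wz WzE] := small _ _ (etrans (mulrC _ _) WE).
have wE : wy * wz = 'X - lambda%:P.
  by apply: polyC_inj; rewrite polyCM -WyE -WzE.
have szw : (size wy <= 1)%N \/ (size wz <= 1)%N.
  have := congr1 (fun p : {poly k} => size p) wE; rewrite size_XsubC.
  have wy0 : wy != 0.
    by apply/eqP => w0; move/eqP: wE; rewrite w0 mul0r eq_sym polyXsubC_eq0.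
  have wz0 : wz != 0.
    by apply/eqP => w0; move/eqP: wE; rewrite w0 mulr0 eq_sym polyXsubC_eq0.
  rewrite size_mul //.
  have aux (a b : nat) : (a + b).-1 = 2%N -> (a <= 1)%N \/ (b <= 1)%N.
    by clear; lia.
  exact: aux.
have scalar_unit (x : {mpoly k[n]}) (w : {poly k}) :
    x != 0 -> x = ev w%:P -> (size w <= 1)%N -> x \is a GRing.unit.
  move=> x0 xE /size1_polyC wC; move: x0; rewrite xE wC evC => w0.
  by rewrite rmorph_unit // unitfE; apply: contra_neq w0 => ->; rewrite mpolyC0.
rewrite WyE in yE; rewrite WzE in zE.
by case: szw => szw; [left; apply: scalar_unit y0 yE szw | right; apply: scalar_unit z0 zE szw].
Qed.

Section Extension.
Variables (k : fieldType) (n : nat).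
Variable delta : {rmorphism {mpoly k[n]} -> {poly {mpoly k[n]}}}.
Variables f t : {mpoly k[n]}.
Hypothesis pc : plane_constants delta f t.
Variables (h : {poly k}) (L : fieldType) (red : {rmorphism {poly k} -> L}).
Hypothesis h_neq0 : h != 0.
Hypothesis red_surj : forall x, exists P, x = red P.
Hypothesis red_ker : forall P, red P = 0 <-> divides h P.

Definition ext : {rmorphism k -> L} := red \o polyC.
Definition mext : {rmorphism {mpoly k[n]} -> {mpoly L[n]}} := map_mpoly ext.
Definition delta_ext : {rmorphism {mpoly L[n]} -> {poly {mpoly L[n]}}} :=
  mmap (polyC \o @mpolyC n L) (fun i => map_poly mext (delta 'X_i)).

Lemma red_peval P : peval ext (red 'X) P = red P.
Proof.
apply: (poly_hom_ext (f := peval ext (red 'X)) (g := red)) => [c|] /=.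
  by rewrite pevalC.
by rewrite pevalX.
Qed.

Lemma bc_field : base_change ext (red 'X) h.
Proof.
split=> [|||Q].
- by rewrite unitfE lead_coef_eq0.
- by rewrite red_peval; apply/red_ker/dvd_refl.
- by move=> b; have [P ->] := red_surj b; exists P; rewrite red_peval.
- by rewrite red_peval => /red_ker.
Qed.

Lemma delta_ext_mext b : delta_ext (mext b) = map_poly mext (delta b).
Proof.
apply: (mpoly_hom_ext (f := delta_ext \o mext) (g := map_poly mext \o delta)) => /= [c|i].
  rewrite map_mpolyC mmapC (scalar_consts _ (pc_at_zero pc)) map_polyC /=.
  by rewrite map_mpolyC.
by rewrite map_mpolyX mmapX mmap1U.
Qed.

Lemma delta_extC c : delta_ext c%:MP = (c%:MP)%:P.
Proof. exact: mmapC. Qed.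

(** Coordinates in the powers of the adjoined root reduce generation and
    independence over [L] to those over [k]. *)
Lemma plane_constants_ext : plane_constants delta_ext (mext f) (mext t).
Proof.
have bcB := bc_mpoly n bc_field.
have evE Q : pev (@mpolyC n L) (mext f) (mext t) (map_poly (map_poly ext) Q)
    = mext (pev (@mpolyC n k) f t Q).
  apply: (poly_hom_ext (f := pev _ _ _ \o map_poly (map_poly ext))
    (g := mext \o pev _ _ _)) => /= [c|].
    rewrite map_polyC /pev /= !pevalC /=.
    apply: (poly_hom_ext (f := peval (@mpolyC n L) (mext f) \o map_poly ext)
      (g := mext \o peval (@mpolyC n k) f)) => /= [a|].
      by rewrite map_polyC !pevalC /= map_mpolyC.
    by rewrite map_polyX !pevalX.
  by rewrite map_polyX /pev /= !pevalX.
split.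
- exact: (bc_at_zero bcB delta_ext_mext (delta_extC _) (pc_at_zero pc)).
- by apply/constsP; rewrite delta_ext_mext (constsP _ _ (pc_f pc)) map_polyC.
- by apply/constsP; rewrite delta_ext_mext (constsP _ _ (pc_t pc)) map_polyC.
- move=> b bC.
  have [Q -> QC] := bc_consts bcB delta_ext_mext (delta_extC _) (pc_at_zero pc) bC.
  pose P (x : {mpoly L[n]}) := exists W, x = pev (@mpolyC n L) (mext f) (mext t) W.
  rewrite pevalE; apply: (big_ind P) => [|x y [W1 ->] [W2 ->]|i _].
  + by exists 0; rewrite rmorph0.
  + by exists (W1 + W2); rewrite rmorphD.
  have [W WE] := pc_gen pc (QC i).
  exists (map_poly (map_poly ext) W * ((red 'X ^+ i)%:P)%:P).
  rewrite [RHS]rmorphM evE -WE; congr (_ * _).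
  by rewrite /pev /= !pevalC /= pevalC rmorphXn.
- have bcT := bc_poly (bc_poly bc_field).
  apply: (bc_injective bcB bcT) (pc_indep pc) => //.
  + rewrite !size_map_polyC; apply: size_map_inj_poly; [exact: mpolyC_injective|exact: mpolyC0].
  + by rewrite /pev /= pevalC /= pevalC.
Qed.

End Extension.

(** Over the field [L] obtained by adjoining a root [mu] of [h], the prime
    [f - lambda] divides [h(s) = h(s) - h(mu)], hence [s - mu] or the cofactor.
    Both are polynomials in [mu] with unit leading coefficient. Since the powers
    of [mu] below the degree of [h] are independent, such a polynomial of degree
    less than that of [h] is not divisible by [f - lambda]; this excludes the
    cofactor, and it excludes [s - mu] unless [h] is linear. *)
Lemma fibre_algebraic_linear (k : fieldType) n
    (delta : {rmorphism {mpoly k[n]} -> {poly {mpoly k[n]}}}) f t (lambda : k) s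
    (h : {poly k}) :
    plane_constants delta f t -> prime_elt h ->
    divides (f - lambda%:MP) (peval (@mpolyC n k) s h) ->
  (size h <= 2)%N.
Proof.
move=> pc hP fh; have h0 : h != 0 by case: hP.
have [L [red [red_surj red_ker]]] := adjoin_root hP.
have bc := bc_mpoly n (bc_field h0 red_surj red_ker).
have pcL := plane_constants_ext pc h0 red_surj red_ker.
set hB := map_poly _ h in bc.
pose RED := peval (mext n red) (red 'X)%:MP.
have szh : size hB = size h.
  by apply: size_map_inj_poly; [apply: mpolyC_injective | apply: mpolyC0].
set c := f - lambda%:MP in fh.
have cP : prime_elt c := fibre_prime lambda pc.
have cLP : prime_elt (RED c%:P).
  rewrite /RED pevalC /= rmorphB /= map_mpolyC.
  exact: fibre_prime pcL.
have no_small (Q : {poly {mpoly k[n]}}) : (size Q < size h)%N ->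
    lead_coef Q \is a GRing.unit -> ~ divides (RED c%:P) (RED Q).
  move=> lt_Q QU; rewrite -szh in lt_Q.
  move/(bc_dvd bc lt_Q)/(dvd_polyC_coef (size Q).-1).
  by rewrite -lead_coefE => /(prime_dvd_nonunit cP); rewrite QU.
have [Q QE] : exists Q, hB - (hB.[s])%:P = Q * ('X - s%:P).
  by apply/factor_theorem; rewrite /root hornerD hornerN hornerC subrr.
have szhB : (1 < size hB)%N.
  rewrite szh ltnNge; apply/negP => /size1_polyC hE; have [_ hU _] := hP.
  by move: hU h0; rewrite hE unit_polyC unitfE polyC_eq0 => /negPn/eqP->; rewrite eqxx.
have lQ : lead_coef Q = lead_coef hB.
  rewrite -(lead_coefDl (q := - (hB.[s])%:P) (p := hB)); last first.
    by rewrite size_polyN (leq_ltn_trans (size_polyC_leq1 _)).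
  by rewrite QE lead_coefM lead_coefXsubC mulr1.
have szQ : (size Q < size h)%N.
  have : size (hB - (hB.[s])%:P) = size h.
    by rewrite size_polyDl // size_polyN (leq_ltn_trans (size_polyC_leq1 _)).
  have Q0 : Q != 0.
    by rewrite -lead_coef_eq0 lQ lead_coef_eq0 -size_poly_gt0 ltnW.
  rewrite QE size_mul ?polyXsubC_eq0 // size_XsubC addn2 /= => <-.
  exact: ltnSn.
rewrite leqNgt; apply/negP => h_gt2.
have [_ _ cLM] := cLP.
case: (cLM (RED Q) (RED ('X - s%:P))).
- have -> : RED Q * RED ('X - s%:P) = - RED (hB.[s])%:P.
    have REDh : RED hB = 0 := bc_root bc.
    by rewrite -[LHS]rmorphM -QE [LHS]rmorphB -[X in X - _]/(RED hB) REDh sub0r.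
  apply: dvd_opp.
  by case: fh => z zE; exists (RED z%:P); rewrite -rmorphM -polyCM /= -zE.
- by apply: no_small => //; rewrite lQ (bc_lead bc).
- by apply: no_small; rewrite ?size_XsubC // lead_coefXsubC unitr1.
Qed.

(** Over the residue field of [p], with [lambda] a root of [p], the prime
    [f - lambda] divides [q(lambda, s)], hence an irreducible factor of it, which
    is linear by [fibre_algebraic_linear]. So [s - c(lambda) = (f - lambda) * z],
    and it remains to replace [lambda] by [f] in a lift of this identity to
    polynomials in a variable [lambda], where it holds modulo [p(lambda)]. *)
Lemma fibre_section (k : fieldType) n
    (delta : {rmorphism {mpoly k[n]} -> {poly {mpoly k[n]}}}) f t s
    (p : {poly k}) (q : {poly {poly k}}) :
    plane_constants delta f t -> prime_elt p -> ~ divides p%:P q ->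
    divides (peval (@mpolyC n k) f p) (pev (@mpolyC n k) f s q) ->
  exists c, divides (peval (@mpolyC n k) f p) (s - peval (@mpolyC n k) f c).
Proof.
move=> pc pP pq fq; have p0 : p != 0 by case: pP.
have [L [red [red_surj red_ker]]] := adjoin_root pP.
have bc := bc_mpoly n (bc_field p0 red_surj red_ker).
have pcL := plane_constants_ext pc p0 red_surj red_ker.
set pB := map_poly _ p in bc.
pose RED := peval (mext n red) (red 'X)%:MP.
set lambda := red 'X in bc; pose j := mext n red.
have cLP : prime_elt (j f - lambda%:MP) := fibre_prime lambda pcL.
set c := j f - lambda%:MP in cLP.
have evP (P : {poly k}) : divides c (j (peval (@mpolyC n k) f P) - (red P)%:MP).
  elim/poly_ind: P => [|P a IHP]; first by exists 0; rewrite !rmorph0 subr0 mul0r.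
  rewrite !rmorphD !rmorphM /= pevalX pevalC.
  rewrite (_ : _ - _ = j f * (j (peval (@mpolyC n k) f P) - (red P)%:MP)
      + (red P)%:MP * (j f - lambda%:MP)).
    by apply: dvd_add; [apply: dvd_mull | apply/dvd_mull/dvd_refl].
  rewrite map_mpolyC /=; ring.
have evq (W : {poly {poly k}}) : divides c
    (j (pev (@mpolyC n k) f s W) - peval (@mpolyC n L) (j s) (map_poly red W)).
  elim/poly_ind: W => [|W a IHW]; first by exists 0; rewrite !rmorph0 subr0 mul0r.
  rewrite !rmorphD !rmorphM /= map_polyX map_polyC !pevalX !pevalC /=.
  rewrite (_ : _ - _ = j s * (j (pev (@mpolyC n k) f s W)
        - peval (@mpolyC n L) (j s) (map_poly red W))
      + (j (peval (@mpolyC n k) f a) - (red a)%:MP)); last by rewrite /=; ring.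
  by apply: dvd_add => //; apply: dvd_mull.
have c_pf : divides c (j (peval (@mpolyC n k) f p)).
  have /red_ker p00 := dvd_refl p.
  by have := evP p; rewrite p00 mpolyC0 subr0.
have c_q : divides c (peval (@mpolyC n L) (j s) (map_poly red q)).
  rewrite -[peval _ _ _](subKr (j (pev (@mpolyC n k) f s q))).
  apply: dvd_sub => //; apply: dvd_trans c_pf _.
  by case: fq => z zE; exists (j z); rewrite -rmorphM /= -zE.
have q0 : map_poly red q != 0.
  apply/eqP => q0; apply: pq; apply: divides_polyC => i.
  by apply/red_ker; rewrite -coef_map q0 coef0.
have [u [l [uU lP qE]]] := ufd_poly (@ufd_field L) q0.
have [h hl ch] : exists2 h, h \in l & divides c (peval (@mpolyC n L) (j s) h).
  move: c_q; rewrite qE rmorphM => /(dvd_unitl _) H.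
  have {H} : divides c (\prod_(h <- map (peval (@mpolyC n L) (j s)) l) h).
    by rewrite big_map -rmorph_prod; apply: H; apply: rmorph_unit.
  by case/(prime_dvd_prod cLP) => _ /mapP[h hl ->]; exists h.
have hP := lP h hl; have [h0 hU _] := hP.
have szh := fibre_algebraic_linear pcL hP ch.
have [a [b [a0 hE]]] : exists a b, a != 0 /\ h = a%:P * 'X + b%:P.
  exists h`_1, h`_0; split.
    apply: contraNneq hU => h10.
    have /size1_polyC -> : (size h <= 1)%N.
      apply/leq_sizeP => -[|[|i]] // _; apply: nth_default.
      exact: leq_trans szh _.
    rewrite unit_polyC unitfE; apply: contra_neq h0 => h00.
    apply/polyP => -[|[|i]]; rewrite coef0 // nth_default //.
    exact: leq_trans szh _.
  apply/polyP => -[|[|i]]; rewrite coefD coefCM coefC coefX ?mulr0 ?mulr1 ?add0r ?addr0 //=.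
  by rewrite nth_default //; apply: leq_trans szh _.
have [c0 c0E] := red_surj (- b / a).
have [z zE] : divides c (j s - (red c0)%:MP).
  have aU : (a%:MP : {mpoly L[n]}) \is a GRing.unit by rewrite rmorph_unit // unitfE.
  apply: (dvd_unitl aU); rewrite mulrBr -mpolyCM -c0E mulrCA divff // mulr1.
  by move: ch; rewrite hE rmorphD rmorphM /= pevalX !pevalC /= mpolyCN opprK.
have [Z ZE] := bc_surj bc z.
have REDC (P : {poly k}) : RED (map_poly (@mpolyC n k) P) = (red P)%:MP.
  apply: (poly_hom_ext (f := RED \o map_poly (@mpolyC n k)) (g := @mpolyC n L \o red)) => /= [d|].
    by rewrite map_polyC /RED pevalC /= map_mpolyC.
  by rewrite map_polyX /RED pevalX.
have [Y YE] : divides pB (s%:P - map_poly (@mpolyC n k) c0 - (f%:P - 'X) * Z).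
  apply: (bc_ker bc); rewrite -[LHS]/(RED _).
  have -> : RED (s%:P - map_poly (@mpolyC n k) c0 - (f%:P - 'X) * Z) =
      j s - (red c0)%:MP - c * RED Z.
    by rewrite /RED !rmorphB rmorphM rmorphB /= -/RED REDC /RED !pevalC pevalX.
  by rewrite zE ZE mulrC subrr.
exists c0; exists Y.[f].
have := congr1 (fun P : {poly {mpoly k[n]}} => P.[f]) YE.
by rewrite /= !hornerE subrr mul0r subr0.
Qed.

(** * Transcendence degree *)

Lemma mmap_morph (k R S : comNzRingType) n (iota : {rmorphism k -> R})
    (phi : {rmorphism R -> S}) (h : 'I_n -> R) (P : {mpoly k[n]}) :
  phi (mmap iota h P) = mmap (phi \o iota) (phi \o h) P.
Proof.
apply: (mpoly_hom_ext (f := phi \o mmap iota h) (g := mmap (phi \o iota) (phi \o h))) => /= [c|i].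
  by rewrite !mmapC.
by rewrite !mmapX !mmap1U.
Qed.

Lemma mmap_eq (k R : comNzRingType) n (iota iota' : {rmorphism k -> R})
    (h h' : 'I_n -> R) (P : {mpoly k[n]}) :
  iota =1 iota' -> h =1 h' -> mmap iota h P = mmap iota' h' P.
Proof.
move=> iE hE; apply: (mpoly_hom_ext (f := mmap iota h) (g := mmap iota' h')) => /= [c|i].
  by rewrite !mmapC; apply: iE.
by rewrite !mmapX !mmap1U; apply: hE.
Qed.

(** The coefficients of a relation, seen as a polynomial in the last element,
    are relations between the others. *)
Lemma dependence_descends (k : fieldType) (R S : comNzRingType) n
    (iotaR : {rmorphism k -> R}) (iotaS : {rmorphism k -> S})
    (phi : {rmorphism R -> S}) (hR : 'I_n -> R) (hS : 'I_n.+1 -> S)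
    (P : {mpoly k[n.+1]}) :
    (forall a, iotaS a = phi (iotaR a)) ->
    (forall i, hS (widen_ord (leqnSn n) i) = phi (hR i)) ->
    (forall Q, peval phi (hS ord_max) Q = 0 -> Q = 0) ->
    P != 0 -> mmap iotaS hS P = 0 ->
  exists2 P' : {mpoly k[n]}, P' != 0 & mmap iotaR hR P' = 0.
Proof.
move=> iE hE indep P0; rewrite mmap_muni => E.
have : map_poly (mmap iotaR hR) (muni P) = 0.
  apply: indep; rewrite -[RHS]E.
  apply: (poly_hom_ext (f := peval phi (hS ord_max) \o map_poly (mmap iotaR hR))
    (g := peval _ _)) => /= [Q|].
    by rewrite map_polyC !pevalC /= mmap_morph; apply: mmap_eq => // i; rewrite -hE.
  by rewrite map_polyX !pevalX.
move=> H; exists (lead_coef (muni P)).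
  by rewrite lead_coef_eq0 muni_eq0.
by rewrite lead_coefE -coef_map H coef0.
Qed.

Lemma mpoly_alg_indep (k : fieldType) n (Q : {mpoly k[n]}) :
  mmap (@mpolyC n k) (fun i => 'X_i) Q = Q.
Proof.
apply: (mpoly_hom_ext (f := mmap (@mpolyC n k) (fun i => 'X_i)) (g := idfun)) => /= [c|i].
  by rewrite mmapC.
by rewrite mmapX mmap1U.
Qed.

Definition pair_fun (T : Type) (x y : T) (i : 'I_2) : T :=
  if i == ord0 then x else y.

Lemma pev_mmap (k R : comNzRingType) (iota : {rmorphism k -> R}) f t W :
  pev iota f t W =
  mmap iota (pair_fun f t) (pev (@mpolyC 2 k) 'X_ord0 'X_ord_max W).
Proof.
pose h := pair_fun f t.
have hX i : mmap iota h 'X_i = h i by rewrite mmapX mmap1U.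
rewrite /pev /= peval_comp /= hX; apply/esym.
apply: (poly_hom_ext
  (f := peval (mmap iota h \o peval (@mpolyC 2 k) 'X_ord0) (h ord_max))
  (g := peval (peval iota f) t)) => [c|] /=; last by rewrite !pevalX.
rewrite !pevalC /= peval_comp /= hX.
apply: (poly_hom_ext (f := peval (mmap iota h \o @mpolyC 2 k) (h ord0))
  (g := peval iota f)) => [a|] /=; last by rewrite !pevalX.
by rewrite !pevalC /= mmapC.
Qed.

Lemma pev_pair_onto (k : comNzRingType) (Q : {mpoly k[2]}) :
  exists W, Q = pev (@mpolyC 2 k) 'X_ord0 'X_ord_max W.
Proof.
pose g : {rmorphism {mpoly k[2]} -> {poly {poly k}}} :=
  mmap (polyC \o polyC) (pair_fun 'X%:P 'X).
exists (g Q); apply/esym.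
apply: (mpoly_hom_ext (f := pev (@mpolyC 2 k) 'X_ord0 'X_ord_max \o g) (g := idfun)) => /= [c|i].
  by rewrite mmapC /pev /= !pevalC /= pevalC.
rewrite mmapX mmap1U /pair_fun; case: eqP => [->|/eqP i0]; rewrite /pev /=.
  by rewrite pevalC /= pevalX.
rewrite pevalX; congr 'X_[U_(_)].
by case: i i0 => [[|[|m]] lt_m] // _; apply/val_inj.
Qed.

(** The three variables would otherwise be images of algebraically dependent
    polynomials in two variables. *)
Lemma not_two_generated (k : fieldType) (f t : {mpoly k[3]}) :
  ~ forall b, exists W, b = pev (@mpolyC 3 k) f t W.
Proof.
move=> gen; pose h := pair_fun f t.
have lift (b : {mpoly k[3]}) : exists P : {mpoly k[2]}, mmap (@mpolyC 3 k) h P = b.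
  by have [W ->] := gen b; rewrite pev_mmap; eexists.
have [P PE] := fin_all_exists (fun i : 'I_3 => lift 'X_i).
have [Q Q0 QE] := algebraic_dependence P.
case/eqP: Q0; rewrite -[LHS]mpoly_alg_indep.
rewrite -[RHS](rmorph0 (mmap (@mpolyC 3 k) h)) -QE mmap_morph.
apply: mmap_eq => [c|i] /=; first by rewrite mmapC.
by rewrite PE.
Qed.

Lemma strip_variable (R : comNzRingType) (Q : {poly R}) : Q != 0 ->
  exists m Q', Q = Q' * 'X^m /\ Q'`_0 != 0.
Proof.
have [n] := ubnP (size Q); elim: n Q => // n IHn Q; rewrite ltnS => le_n Q0.
have [Q00|Q00] := eqVneq Q`_0 0; last by exists 0%N, Q; rewrite expr0 mulr1.
have [Q1 QE] := polyX_factor Q00.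
have Q10 : Q1 != 0 by apply: contra_neq Q0 => z; rewrite QE z mul0r.
have [|m [Q' [Q'E Q'0]]] := IHn Q1 _ Q10.
  by apply: leq_trans le_n; rewrite QE size_mulX.
by exists m.+1, Q'; split=> //; rewrite QE Q'E exprSr mulrA.
Qed.

Section LiftMorphism.
Variables (R S : idomainType) (sigma : {rmorphism R -> {poly R}}).
Variables (f : {rmorphism S -> R}) (fC : forall x, f x \in consts sigma).

Definition lift_fun x : const_ring sigma := Sub (f x) (fC x).

Fact lift_zmod_morphism : zmod_morphism lift_fun.
Proof. by move=> x y; apply: val_inj; rewrite /= rmorphB. Qed.

Fact lift_monoid_morphism : monoid_morphism lift_fun.
Proof. by split=> [|x y]; apply: val_inj; rewrite /= ?rmorph1 ?rmorphM. Qed.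

HB.instance Definition _ := GRing.isZmodMorphism.Build S (const_ring sigma)
  lift_fun lift_zmod_morphism.
HB.instance Definition _ := GRing.isMonoidMorphism.Build S (const_ring sigma)
  lift_fun lift_monoid_morphism.

Definition lift_const : {rmorphism S -> const_ring sigma} := lift_fun.

End LiftMorphism.

Lemma map_poly_surj (R S : nzRingType) (f : {rmorphism R -> S}) :
  (forall y, exists x, y = f x) -> forall q, exists p, q = map_poly f p.
Proof.
move=> f_surj; elim/poly_ind => [|q c [p ->]]; first by exists 0; rewrite rmorph0.
have [a ->] := f_surj c; exists (p * 'X + a%:P).
by rewrite rmorphD rmorphM /= map_polyX map_polyC.
Qed.

(** * Cancellation for the plane *)

Section Cancellation.
Variables (k : fieldType) (A : idomainType).
Variables (Theta : {rmorphism {poly A} -> {mpoly k[3]}}).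
Variables (Xi : {rmorphism {mpoly k[3]} -> {poly A}}).
Hypotheses (ThetaK : cancel Theta Xi) (XiK : cancel Xi Theta).
Hypothesis facA : ufd A.
Local Notation C3 := (@mpolyC 3 k).

Definition base_point : {rmorphism {mpoly k[3]} -> A} := horner_eval 0 \o Xi.
Definition scalarA : {rmorphism k -> A} := base_point \o C3.
Definition inclA : {rmorphism A -> {mpoly k[3]}} := Theta \o polyC.

Lemma inclA_scalar c : inclA (scalarA c) = c%:MP.
Proof.
rewrite /inclA /scalarA /base_point /= /horner_eval horner_coef0 -[RHS]XiK.
apply: (congr1 Theta); apply/esym/size1_polyC.
have [->|c0] := eqVneq c 0; first by rewrite mpolyC0 rmorph0 size_poly0.
have : Xi c%:MP \is a GRing.unit by rewrite !rmorph_unit // unitfE.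
by rewrite poly_unitE => /andP[/eqP->].
Qed.

Lemma base_pointK a : base_point (inclA a) = a.
Proof. by rewrite /base_point /inclA /= /horner_eval ThetaK hornerC. Qed.

Lemma inclA_inj : injective inclA.
Proof. exact: can_inj base_pointK. Qed.

Lemma inclA_dvd x y : divides (inclA x) (inclA y) -> divides x y.
Proof. by case=> z E; exists (base_point z); rewrite -[y]base_pointK E rmorphM base_pointK. Qed.

Lemma inclA_peval a P : inclA (peval scalarA a P) = peval C3 (inclA a) P.
Proof.
rewrite peval_comp; apply: (poly_hom_ext (f := peval (inclA \o scalarA) (inclA a))
  (g := peval C3 (inclA a))) => [c|] /=; last by rewrite !pevalX.
by rewrite !pevalC; apply: inclA_scalar.
Qed.

Lemma inclA_pev a b W : inclA (pev scalarA a b W) = pev C3 (inclA a) (inclA b) W.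
Proof.
rewrite [LHS](peval_comp (peval scalarA a) b inclA).
apply: (poly_hom_ext (f := peval (inclA \o peval scalarA a) (inclA b))
  (g := peval (peval C3 (inclA a)) (inclA b))) => [c|] /=; last by rewrite !pevalX.
by rewrite !pevalC; apply: inclA_peval.
Qed.

Lemma Theta_peval P : Theta P = peval inclA (Theta 'X) P.
Proof.
apply: (poly_hom_ext (f := Theta) (g := peval inclA (Theta 'X))) => [c|] /=.
  by rewrite pevalC.
by rewrite pevalX.
Qed.

Lemma Theta_gen f (P : {poly A}) :
    (forall i, exists V, inclA P`_i = peval C3 f V) ->
  exists W, Theta P = pev C3 f (Theta 'X) W.
Proof.
elim/poly_ind: P => [|P a IHP] H; first by exists 0; rewrite !rmorph0.
have [|W WE] := IHP.
  by move=> i; have := H i.+1; rewrite coefD coefMX coefC /= addr0.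
have := H 0%N; rewrite coefD coefMX coefC eqxx add0r => -[V VE].
exists (W * 'X + V%:P).
by rewrite !rmorphD !rmorphM /= -WE /pev /= pevalX pevalC /= -VE.
Qed.

Lemma not_gen_by_scalars f : ~ forall a, exists V, inclA a = peval C3 f V.
Proof.
move=> gen; apply: (@not_two_generated k f (Theta 'X)) => b.
by rewrite -[b]XiK; apply: Theta_gen.
Qed.

(** Some shift of the three variables moves an element of [A], as the elements
    fixed by all of them are scalars. *)
Lemma exp_map_on_A : exists delta : {rmorphism A -> {poly A}},
  [/\ at_zero delta, exp_law delta & exists a, a \notin consts delta].
Proof.
have pi_surj a : exists p, a = base_point p by exists (inclA a); rewrite base_pointK.
have [i [a aN]] : exists i a, a%:P \notin consts (transport Theta Xi (shift k i)).
  apply: NNPP => H; apply: (@not_gen_by_scalars 0) => a.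
  have [c cE] : exists c, inclA a = c%:MP.
    apply: shift_constants => i; apply: NNPP => /negP N; apply: H.
    by exists i, a; rewrite transport_consts.
  by exists c%:P; rewrite pevalC.
apply: (descend_exp_map pi_surj (tau := transport Theta Xi (shift k i))).
- exact: (transport_at_zero ThetaK (@shift_at_zero k 3 i)).
- exact: (transport_exp_law XiK (@shift_exp_law k 3 i)).
- by exists a.
Qed.

Variable delta : {rmorphism A -> {poly A}}.
Hypotheses (delta0 : at_zero delta) (deltaD : exp_law delta).
Local Notation C := (const_ring delta).
Local Notation val := (const_val delta).

Lemma scalarA_consts c : scalarA c \in consts delta.
Proof.
have [->|c0] := eqVneq c 0; first by rewrite rmorph0 rpred0.
by apply: (unit_consts delta0); rewrite rmorph_unit // unitfE.
Qed.

Definition scalarC : {rmorphism k -> C} := lift_const scalarA_consts.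

Lemma val_scalar c : val (scalarC c) = scalarA c.
Proof. by []. Qed.

Lemma val_peval f P : val (peval scalarC f P) = peval scalarA (val f) P.
Proof.
rewrite peval_comp; apply: (poly_hom_ext (f := peval (val \o scalarC) (val f))
  (g := peval scalarA (val f))) => [c|] /=; last by rewrite !pevalX.
by rewrite !pevalC.
Qed.

Lemma pev_val s f W : pev scalarA (val f) s W = peval val s (map_poly (peval scalarC f) W).
Proof.
apply: (poly_hom_ext (f := pev scalarA (val f) s)
  (g := peval val s \o map_poly (peval scalarC f))) => /= [P|].
  by rewrite map_polyC /pev /= !pevalC /= val_peval.
by rewrite map_polyX /pev /= !pevalX.
Qed.

Variable s : A.
Hypothesis s_min : minimal_slice delta s.

(** If all constants were scalars, [A] would be generated by [s], and the
    polynomial ring in three variables by [s] and [t]. *)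
Lemma nonscalar_constant : exists g : C, forall a, g != scalarC a.
Proof.
apply: NNPP => H.
have scal c : exists a, c = scalarC a.
  apply: NNPP => N; apply: H; exists c => a; apply/eqP => E.
  by apply: N; exists a.
apply: (@not_gen_by_scalars (inclA s)) => a.
have [c [Q [c0 QE]]] := slice_generates delta0 deltaD a s_min.
have [d dE] := scal c; have [V VE] := map_poly_surj scal Q.
have d0 : d != 0 by apply: contra_neq c0 => d0; rewrite dE d0 rmorph0.
exists (d^-1 *: V); rewrite pevalZ -inclA_peval.
have -> : peval scalarA s V = scalarA d * a.
  rewrite -val_scalar -dE QE VE.
  apply: (poly_hom_ext (f := peval scalarA s) (g := peval val s \o map_poly scalarC)) => /= [b|].
    by rewrite map_polyC !pevalC.
  by rewrite map_polyX !pevalX.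
rewrite rmorphM /= -[Theta (scalarA d)%:P]/(inclA (scalarA d)) inclA_scalar.
by rewrite mulrA -mpolyCM mulVf // mpolyC1 mul1r.
Qed.

(** [t], [s], and two elements of [C] are dependent, being four polynomials in
    three variables; so any two elements of [C] are dependent. *)
Lemma constants_dependent (g c : C) : exists2 P : {mpoly k[2]}, P != 0 &
  mmap scalarC (pair_fun g c) P = 0.
Proof.
pose hC := pair_fun g c.
pose hA (i : 'I_3) := if unlift ord_max i is Some j then val (hC j) else s.
pose hB (i : 'I_4) := if unlift ord_max i is Some j then inclA (hA j) else Theta 'X.
have [P P0 PE] := algebraic_dependence hB.
have scalB a : C3 a = inclA (scalarA a) by rewrite inclA_scalar.
have hB_A i : hB (widen_ord (leqnSn 3) i) = inclA (hA i) by rewrite /hB widen_ord_lift liftK.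
have indepB Q : peval inclA (hB ord_max) Q = 0 -> Q = 0.
  by rewrite /hB unlift_none -Theta_peval -{2}[Q]ThetaK => ->; rewrite rmorph0.
have [P1 P10 P1E] := dependence_descends scalB hB_A indepB P0 PE.
have hA_C i : hA (widen_ord (leqnSn 2) i) = val (hC i) by rewrite /hA widen_ord_lift liftK.
have indepA Q : peval val (hA ord_max) Q = 0 -> Q = 0.
  by rewrite /hA unlift_none; apply: peval_slice_eq0; case: s_min.
have [P2 P20 P2E] := dependence_descends (fun a => esym (val_scalar a)) hA_C indepA P10 P1E.
by exists P2.
Qed.

(** A substitution [psi] keeping one element [g] of [C] non-constant is
    injective on [C]. Otherwise take a relation between [g] and a nonzero [c]
    with [psi c = 0]; after division by a power of [c], setting [c = 0] leaves a
    non-trivial polynomial satisfied by [psi g]. *)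
Lemma embed_constants : exists psi : {rmorphism C -> {poly k}},
  injective psi /\ forall a, psi (scalarC a) = a%:P.
Proof.
have [g gN] := nonscalar_constant.
have g'N c : inclA (val g) != c%:MP.
  apply: contraNneq (gN c) => E; apply/eqP/const_val_inj/inclA_inj.
  by rewrite E val_scalar inclA_scalar.
have [|w [_ wN]] := @kronecker_substitution k 3 (inclA (val g)).
  by have := g'N 0; rewrite mpolyC0.
pose psi : {rmorphism C -> {poly k}} := mmap polyC w \o inclA \o val.
have psi_scalar a : psi (scalarC a) = a%:P.
  by rewrite /psi /= -[Theta _]/(inclA (scalarA a)) inclA_scalar mmapC.
exists psi; split=> //; apply: raddf_inj => c cE.
have g1 : (1 < size (psi g))%N := wN g'N.
apply/eqP; apply: contraT => c0.
have [P P0] := constants_dependent g c.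
rewrite mmap_muni /= => PE.
have [m [Q [QE Q0]]] : exists m Q, muni P = Q * 'X^m /\ Q`_0 != 0.
  by apply: strip_variable; rewrite muni_eq0.
set ev := mmap _ _ in PE.
have evQ : peval ev c Q = 0.
  apply: (mulIf (expf_neq0 m c0)); rewrite mul0r -[RHS]PE QE.
  by rewrite [RHS]rmorphM /= pevalXn.
have := congr1 psi evQ; rewrite peval_comp cE rmorph0 peval_at0 /= => E.
have indep R : peval (polyC : {rmorphism k -> {poly k}}) (psi g) R = 0 -> R = 0.
  by move=> R0; apply/eqP; rewrite -(comp_poly_eq0 _ g1); apply/eqP.
have Q0E : mmap polyC (fun _ : 'I_1 => psi g) Q`_0 = 0.
  rewrite -[RHS]E [RHS](mmap_morph _ psi); apply: mmap_eq => [a|i] /=.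
    exact: esym (psi_scalar a).
  by rewrite ord1.
have [||P' P'0] := dependence_descends (iotaR := idfun : {rmorphism k -> k})
    (hR := fun=> 0) _ _ indep Q0 Q0E => //; first by case.
rewrite (mpoly0_scalar P') mmapC /= => z; case/eqP: P'0.
by rewrite (mpoly0_scalar P') z mpolyC0.
Qed.

Lemma constants_polynomial : exists f : C,
  (forall c, exists P, c = peval scalarC f P) /\
  (forall P, peval scalarC f P = 0 -> P = 0).
Proof.
have [psi [psi_inj psi_scalar]] := embed_constants.
have [f [fN f_gen]] :=
  luroth (ufd_const_ring delta0 facA) psi_inj psi_scalar nonscalar_constant.
exists f; split=> // P P0.
have f1 := size_psi psi_inj psi_scalar fN.
apply/eqP; rewrite -(comp_poly_eq0 _ f1); apply/eqP.
transitivity (psi (peval scalarC f P)); last by rewrite P0 rmorph0.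
rewrite peval_comp; apply: (poly_hom_ext (f := comp_poly (psi f))
  (g := peval (psi \o scalarC) (psi f))) => [c|] /=.
  by rewrite comp_polyC pevalC; apply: esym (psi_scalar c).
by rewrite comp_polyX pevalX.
Qed.

Variable f : C.
Hypothesis f_gen : forall c, exists P, c = peval scalarC f P.
Hypothesis f_indep : forall P, peval scalarC f P = 0 -> P = 0.
Local Notation fA := (val f).

Definition delta_poly : {rmorphism {poly A} -> {poly {poly A}}} :=
  @swapXY A \o map_poly delta.

Definition deltaB : {rmorphism {mpoly k[3]} -> {poly {mpoly k[3]}}} :=
  transport Xi Theta delta_poly.

Lemma delta_poly_consts P :
  (P \in consts delta_poly) <-> (forall i, P`_i \in consts delta).
Proof.
split=> [/constsP PC i|PC].
  apply/constsP; have := congr1 (@swapXY A) PC.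
  by rewrite swapXYK swapXY_polyC => E; rewrite -coef_map E coef_map.
apply/constsP; rewrite /delta_poly /= -swapXY_map_polyC; congr swapXY.
by apply/polyP => i; rewrite !coef_map /=; apply/constsP/PC.
Qed.

Lemma deltaB_plane_constants :
  plane_constants deltaB (inclA fA) (Theta 'X).
Proof.
split.
- apply: (transport_at_zero XiK) => P; apply/polyP => i.
  by rewrite coef_swapXY coef_map delta0.
- rewrite transport_consts // ThetaK; apply/delta_poly_consts => i.
  by rewrite coefC; case: ifP => _; [exact: (valP f) | exact: rpred0].
- rewrite transport_consts // ThetaK; apply/delta_poly_consts => i.
  by rewrite coefX rpred_nat.
- move=> b; rewrite transport_consts // => /delta_poly_consts bC.
  rewrite -[b]XiK; apply: Theta_gen => i.
  have [c cE] := consts_lift (bC i); have [V VE] := f_gen c.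
  by exists V; rewrite cE VE val_peval inclA_peval.
- move=> W W0; have : map_poly (peval scalarA fA) W = 0.
    apply: (can_inj ThetaK); rewrite rmorph0 -[RHS]W0.
    apply: (poly_hom_ext (f := Theta \o map_poly (peval scalarA fA))
      (g := pev C3 (inclA fA) (Theta 'X))) => /= [P|].
      rewrite map_polyC /pev /= pevalC -[LHS]/(inclA (peval scalarA fA P)).
      exact: inclA_peval.
    by rewrite map_polyX /pev /= pevalX.
  move=> E; apply/polyP => i; rewrite coef0; apply/f_indep/const_val_inj.
  by rewrite rmorph0 val_peval -coef_map E coef0.
Qed.

Lemma pev_indep W : pev scalarA fA s W = 0 -> W = 0.
Proof.
rewrite pev_val => /(peval_slice_eq0 delta0); case: s_min => sN _ /(_ sN) E.
by apply/polyP => i; rewrite coef0; apply: f_indep; rewrite -coef_map E coef0.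
Qed.

Lemma fibre_section_A (p : {poly k}) (q : {poly {poly k}}) :
    prime_elt p -> ~ divides p%:P q ->
    divides (peval scalarA fA p) (pev scalarA fA s q) ->
  exists c, divides (peval scalarA fA p) (s - peval scalarA fA c).
Proof.
move=> pP pq [z zE].
have [|c H] := fibre_section (s := inclA s) (q := q) deltaB_plane_constants pP pq.
  by exists (inclA z); rewrite -inclA_pev zE rmorphM -inclA_peval.
exists c; apply: inclA_dvd.
by rewrite rmorphB inclA_peval [X in _ - X]inclA_peval.
Qed.

(** The prime factors of the denominator of [a] can be cancelled one at a
    time. *)
Lemma generated_without_denominators :
    (forall p q, prime_elt p -> divides (peval scalarA fA p) (pev scalarA fA s q) ->
      divides p%:P q) ->
  forall a, exists W, a = pev scalarA fA s W.
Proof.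
move=> good a.
have [c [Q [c0 QE]]] := slice_generates delta0 deltaD a s_min.
have [P PE] := f_gen c; have [q qE] := map_poly_surj f_gen Q.
have P0 : P != 0 by apply: contra_neq c0 => z; rewrite PE z rmorph0.
have {qE PE c0 QE} : peval scalarA fA P * a = pev scalarA fA s q.
  by rewrite pev_val -qE -QE PE val_peval.
have [n] := ubnP (size P); elim: n P q P0 => // n IHn P q P0; rewrite ltnS => le_n E.
have PA0 : peval scalarA fA P != 0.
  apply: contra_neq P0 => z; apply/f_indep/const_val_inj.
  by rewrite val_peval z rmorph0.
case: (ufd_prime_factor (ufd_poly (@ufd_field k)) P0) => [PU|[p pP [P1 P1E]]].
  exists ((P^-1)%:P * q); rewrite rmorphM -E mulrA /pev /= pevalC -rmorphM mulVr //.
  by rewrite rmorph1 mul1r.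
have [|q1 q1E] := good p q pP.
  by rewrite -E P1E rmorphM -mulrA mulrCA; exists (peval scalarA fA P1 * a); rewrite mulrC.
have P10 : P1 != 0 by apply: contra_neq P0 => z; rewrite P1E z mul0r.
have pA0 : peval scalarA fA p != 0.
  by apply: contra_neq PA0 => z; rewrite P1E rmorphM /= z mulr0.
apply: (IHn P1 q1 P10).
  apply: leq_trans le_n; rewrite P1E.
  have [p0 pU _] := pP; rewrite size_mul // -[size p]prednK ?size_poly_gt0 //.
  rewrite addnS /= -[X in (X < _)%N]addn0 ltn_add2l -subn1 subn_gt0 ltnNge.
  apply: contra pU => /size1_polyC pE; rewrite pE unit_polyC unitfE.
  by apply: contra_neq p0 => z; rewrite pE z.
apply: (mulIf pA0); rewrite mulrAC -[_ * peval _ _ p]rmorphM -P1E E q1E rmorphM.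
by congr (_ * _); rewrite /pev /= pevalC.
Qed.

End Cancellation.

Section Main.
Variables (k : fieldType) (A : idomainType).
Variables (Theta : {rmorphism {poly A} -> {mpoly k[3]}}).
Variables (Xi : {rmorphism {mpoly k[3]} -> {poly A}}).
Hypotheses (ThetaK : cancel Theta Xi) (XiK : cancel Xi Theta).
Hypothesis facA : ufd A.

(** Take the minimal slice [s] with leading coefficient of
    least degree in [f]; if [A] were larger than [k[f, s]], then
    [(s - c(f)) / p(f)] would be a better one. *)
Theorem cancellation : exists f s : A,
  (forall a, exists W, a = pev (scalarA Xi) f s W) /\
  (forall W, pev (scalarA Xi) f s W = 0 -> W = 0).
Proof.
have [delta [delta0 deltaD nontriv]] := exp_map_on_A ThetaK XiK.
have [s0 s0_min] := minimal_slice_exists nontriv.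
have [f [f_gen f_indep]] := constants_polynomial ThetaK XiK facA delta0 deltaD s0_min.
set scal := scalarC _ _ in f_gen f_indep.
set fA := const_val delta f.
have valE P : const_val delta (peval scal f P) = peval (scalarA Xi) fA P by apply: val_peval.
have lead_gen s : exists P, lead_coef (delta s) = peval (scalarA Xi) fA P.
  have [c cE] := consts_lift (lead_sigma_const deltaD s).
  by have [P PE] := f_gen c; exists P; rewrite cE PE valE.
have peval_inj P : peval (scalarA Xi) fA P = 0 -> P = 0.
  by move=> z; apply/f_indep/const_val_inj; rewrite valE z rmorph0.
have [P lE] := lead_gen s0.
have [n] := ubnP (size P); elim: n s0 P s0_min lE => // n IHn s P s_min lE.
rewrite ltnS => le_n.
case: (classic (forall p q, prime_elt p ->
  divides (peval (scalarA Xi) fA p) (pev (scalarA Xi) fA s q) -> divides p%:P q)).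
  move=> good; exists fA, s; split.
    exact: (generated_without_denominators deltaD s_min f_gen f_indep good).
  exact: (pev_indep s_min f_indep).
case/not_all_ex_not => p /not_all_ex_not[q H].
case: (imply_to_and _ _ H) => pP {}H; case: (imply_to_and _ _ H) => fq pq.
have [c [s' s'E]] := fibre_section_A ThetaK XiK f_gen f_indep pP pq fq.
have [p0 pU _] := pP.
have pA0 : peval (scalarA Xi) fA p != 0 by apply: contra_neq p0; apply: peval_inj.
have pC (R : {poly k}) : peval (scalarA Xi) fA R \in consts delta.
  by rewrite -valE; apply: (valP (peval scal f R)).
have [sN sM] := s_min.
have s'N : s' \notin consts delta.
  apply: contra sN => s'C; rewrite -[s](subrK (peval (scalarA Xi) fA c)) s'E.
  by rewrite rpredD ?rpredM.
have s'0 : s' != 0 by apply: contraNneq s'N => ->; rewrite rpred0.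
have s'_min : minimal_slice delta s'.
  split=> // y yN; apply: leq_trans (sM y yN).
  have := sdeg_sub_const delta0 s (pC c); rewrite s'E (sdeg_mul delta0) //.
  exact: leq_trans (leq_addr _ _).
have [P' l'E] := lead_gen s'.
apply: (IHn s' P' s'_min l'E).
have leadE : lead_coef (delta s) = lead_coef (delta s') * peval (scalarA Xi) fA p.
  have : lead_coef (delta (s - peval (scalarA Xi) fA c)) = lead_coef (delta s).
    rewrite rmorphB /= (constsP _ _ (pC c)) lead_coefDl // size_polyN.
    apply: leq_ltn_trans (size_polyC_leq1 _) _.
    by rewrite ltnNge -(consts_size delta0).
  by move=> <-; rewrite s'E rmorphM lead_coefM (constsP _ _ (pC p)) lead_coefC.
have PE : P = P' * p.
  apply/eqP; rewrite -subr_eq0; apply/eqP/peval_inj.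
  by rewrite rmorphB rmorphM /= -lE -l'E leadE subrr.
have P0 : P != 0.
  apply: contraNneq sN => z; move/eqP: lE; rewrite z rmorph0 lead_coef_eq0.
  by rewrite (sigma_eq0 delta0) => /eqP ->; rewrite rpred0.
have P'0 : P' != 0 by apply: contra_neq P0 => z; rewrite PE z mul0r.
apply: leq_trans le_n; rewrite PE size_mul // -[size p]prednK ?size_poly_gt0 //.
rewrite addnS /= -[X in (X < _)%N]addn0 ltn_add2l -subn1 subn_gt0 ltnNge.
apply: contra pU => /size1_polyC pE; rewrite pE unit_polyC unitfE.
by apply: contra_neq p0 => z; rewrite pE z.
Qed.

End Main.

(** * Retracts of the polynomial ring in three variables *)

Section InverseAlgebraMorphism.
Variables (k : fieldType) (B R S : algType k).
Variables (v : {rmorphism R -> B}) (e : {rmorphism S -> B}).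
Hypothesis e_inj : injective e.
Hypotheses (vZ : scalable v) (eZ : scalable e).
Variable F : R -> S.
Hypothesis eF : forall x, e (F x) = v x.

Definition factor_fun (x : R) : S := F x.

Fact factor_zmod_morphism : zmod_morphism factor_fun.
Proof. by move=> x y; apply: e_inj; rewrite rmorphB /factor_fun !eF rmorphB. Qed.

Fact factor_monoid_morphism : monoid_morphism factor_fun.
Proof.
by split=> [|x y]; apply: e_inj; rewrite ?rmorphM ?rmorph1 /factor_fun !eF ?rmorphM ?rmorph1.
Qed.

Fact factor_scalable : scalable factor_fun.
Proof. by move=> c x; apply: e_inj; rewrite eZ /factor_fun !eF vZ. Qed.

HB.instance Definition _ := GRing.isZmodMorphism.Build R S factor_fun
  factor_zmod_morphism.
HB.instance Definition _ := GRing.isMonoidMorphism.Build R S factor_fun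
  factor_monoid_morphism.
HB.instance Definition _ := GRing.isScalable.Build k R S *:%R factor_fun
  factor_scalable.

Definition factor_morphism : {lrmorphism R -> S} := factor_fun.

End InverseAlgebraMorphism.

Lemma isomorphic_images (k : fieldType) (B R S : algType k)
    (v : {rmorphism R -> B}) (e : {rmorphism S -> B}) :
    injective v -> injective e -> scalable v -> scalable e ->
    (forall x, exists y, e y = v x) -> (forall y, exists x, v x = e y) ->
  alg_isomorphic R S.
Proof.
move=> v_inj e_inj vZ eZ ve ev.
have ve' x : exists y, e y == v x by have [y /eqP] := ve x; exists y.
have ev' y : exists x, v x == e y by have [x /eqP] := ev y; exists x.
pose F x := xchoose (ve' x); pose G y := xchoose (ev' y).
have eF x : e (F x) = v x by apply/eqP/(xchooseP (ve' x)).
have vG y : v (G y) = e y by apply/eqP/(xchooseP (ev' y)).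
exists (factor_morphism e_inj vZ eZ eF); exists G => [x|y].
  by apply: (v_inj); rewrite vG eF.
by apply: (e_inj); rewrite eF vG.
Qed.

Theorem corollary3p2 (k : fieldType) (A : subalgClosed {mpoly k[3]}) :
  is_retract A ->
  (exists sigma : poly_khom {mpoly k[3]},
     [/\ is_exponential_map sigma, exp_nontrivial sigma
       & A =i exp_constants sigma]) ->
  alg_isomorphic (subalg_type A) {mpoly k[2]}.
Proof.
case=> phi [phiK phiA] [sigma [[sigma_0 sigma_add] sigma_nt AE]].
pose sig : {rmorphism {mpoly k[3]} -> {poly {mpoly k[3]}}} := sigma.
have sig0 : at_zero sig by move=> x; rewrite -horner_coef0; apply: sigma_0.
have sigD : exp_law sig by apply: exp_law_of_comp; apply: sigma_add.
pose phir : {rmorphism {mpoly k[3]} -> {mpoly k[3]}} := phi.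
have AC x : (x \in A) = (x \in consts sig) by rewrite AE.
have nontriv : exists x, x \notin consts sig.
  apply: NNPP => H; apply: sigma_nt => x; rewrite -AE AC [RHS]inE.
  by apply: NNPP => /negP xN; apply: H; exists x.
have phi_in x : phir x \in consts sig by rewrite -AC; apply/phiA; exists x.
have phi_id x : x \in consts sig -> phir x = x.
  by rewrite -AC => /phiA[y <-]; apply: phiK.
have [A0 [Theta [Xi [ThetaK XiK facA0 A0E]]]] :=
  retract_presentation (@ufd_mpoly k 3) sig0 sigD phi_in phi_id nontriv.
have [f [s [fs_gen fs_indep]]] := cancellation ThetaK XiK facA0.
pose h := pair_fun (inclA Theta f) (inclA Theta s).
pose e : {rmorphism {mpoly k[2]} -> {mpoly k[3]}} := mmap (@mpolyC 3 k) h.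
have eE W : e (pev (@mpolyC 2 k) 'X_ord0 'X_ord_max W) =
    Theta (pev (scalarA Xi) f s W)%:P.
  exact: etrans (esym (pev_mmap (@mpolyC 3 k) _ _ W)) (esym (inclA_pev XiK f s W)).
pose v : {rmorphism subalg_type A -> {mpoly k[3]}} :=
  (\val : subalg_type A -> {mpoly k[3]}).
apply: (@isomorphic_images k {mpoly k[3]} (subalg_type A) {mpoly k[2]} v e).
- exact: val_inj.
- apply: raddf_inj => Q; have [W ->] := pev_pair_onto Q => E.
  have /polyC_inj/fs_indep-> : (pev (scalarA Xi) f s W)%:P = 0%:P.
    by apply: (can_inj ThetaK); rewrite rmorph0; apply: etrans (esym (eE W)) E.
  exact: rmorph0.
- by [].
- by move=> c Q; rewrite /e /= mmapZ mul_mpolyC.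
- move=> x; have /A0E[a aE] : \val x \in consts sig by rewrite -AC; apply: valP.
  have [W WE] := fs_gen a; exists (pev (@mpolyC 2 k) 'X_ord0 'X_ord_max W).
  by apply: etrans (eE W) _; rewrite -WE -aE.
- move=> Q; have [W ->] := pev_pair_onto Q.
  pose b := Theta (pev (scalarA Xi) f s W)%:P.
  have bA : b \in A by rewrite AC; apply/A0E; exists (pev (scalarA Xi) f s W).
  exists (Sub b bA : subalg_type A); apply: etrans (esym (eE W)).
  exact: SubK.
Qed.
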